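(* Let $\Lambda$ be a row-finite $k$-graph without sources and let $R$ be a commutative ring with $1\neq0$. Then every basic ideal of $\mathrm{KP}_R(\Lambda)$ is graded if and only if $\Lambda\setminus H$ is aperiodic for every saturated hereditary subset $H$ of $\Lambda^0$.
   Context: Conventions: $\mathbb{N}$ includes $0$, and $k$ is a positive integer. For $m,n\in\mathbb{N}^k$, $m\le n$ is coordinatewise and $m\vee n$ is the coordinatewise maximum. Rings and $R$-algebras are associative but not assumed to have an identity; ideals are two-sided. A $k$-graph is a countable category $\Lambda$ (with object set $\Lambda^0$, set of morphisms also written $\Lambda$, domain map $s$, codomain map $r$; $\lambda\mu$ is defined when $s(\lambda)=r(\mu)$) together with a functor $d:\Lambda\to\mathbb{N}^k$ (where $\mathbb{N}^k$ is viewed as a category with one object) with the factorization property: if $d(\lambda)=m+n$ there are unique $\mu,\nu\in\Lambda$ with $d(\mu)=m$, $d(\nu)=n$, $\lambda=\mu\nu$. Objects are identified with identity morphisms, so $\Lambda^0=d^{-1}(0)$. Write $\Lambda^n=d^{-1}(n)$, $v\Lambda=\{\lambda\in\Lambda:r(\lambda)=v\}$ and $v\Lambda^n=v\Lambda\cap\Lambda^n$. $\Lambda$ is row-finite if every $v\Lambda^n$ ($v\in\Lambda^0$, $n\in\mathbb{N}^k$) is finite, and has no sources if every $v\Lambda^n$ is nonempty. For $\lambda\in\Lambda$ and $0\le m\le n\le d(\lambda)$, write $\lambda=\lambda'\lambda''\lambda'''$ uniquely with $d(\lambda')=m$, $d(\lambda'')=n-m$, $d(\lambda''')=d(\lambda)-n$,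 and put $\lambda(m,n):=\lambda''$. A $k$-graph $\Lambda$ is aperiodic if for every $v\in\Lambda^0$ and all $m\neq n$ in $\mathbb{N}^k$ there is $\lambda\in v\Lambda$ with $d(\lambda)\ge m\vee n$ and $\lambda(m,m+d(\lambda)-(m\vee n))\neq\lambda(n,n+d(\lambda)-(m\vee n))$. A subset $H\subset\Lambda^0$ is hereditary if $\lambda\in\Lambda$ and $r(\lambda)\in H$ imply $s(\lambda)\in H$; it is saturated if $v\in\Lambda^0$, $n\in\mathbb{N}^k$ and $s(v\Lambda^n)\subset H$ imply $v\in H$. For $H$ saturated and hereditary, $\Lambda\setminus H$ is the row-finite $k$-graph without sources (possibly empty) with objects $\Lambda^0\setminus H$ and morphisms $s^{-1}(\Lambda^0\setminus H)$, with structure inherited from $\Lambda$. Let $\Lambda^{\neq0}=\{\lambda\in\Lambda:d(\lambda)\neq0\}$. For each $\lambda\in\Lambda^{\neq0}$ introduce a formal symbol $\lambda^*$ (ghost path), and let $G(\Lambda^{\neq0})=\{\lambda^*:\lambda\in\Lambda^{\neq0}\}$. A Kumjian-Pask $\Lambda$-family $(P,S)$ in an $R$-algebra $A$ consists of functions $P:\Lambda^0\to A$ and $S:\Lambda^{\neq0}\cup G(\Lambda^{\neq0})\to A$ such that: (KP1) $\{P_v:v\in\Lambda^0\}$ is a family of mutually orthogonal idempotents; (KP2) for all $\lambda,\mu\in\Lambda^{\neq0}$ with $r(\mu)=s(\lambda)$: $S_\lambda S_\mu=S_{\lambda\mu}$, $S_{\mu^*}S_{\lambda^*}=S_{(\lambda\mu)^*}$,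 $P_{r(\lambda)}S_\lambda=S_\lambda=S_\lambda P_{s(\lambda)}$, $P_{s(\lambda)}S_{\lambda^*}=S_{\lambda^*}=S_{\lambda^*}P_{r(\lambda)}$; (KP3) for all $\lambda,\mu\in\Lambda^{\neq0}$ with $d(\lambda)=d(\mu)$: $S_{\lambda^*}S_\mu=\delta_{\lambda,\mu}P_{s(\lambda)}$; (KP4) for all $v\in\Lambda^0$ and $n\in\mathbb{N}^k\setminus\{0\}$: $P_v=\sum_{\lambda\in v\Lambda^n}S_\lambda S_{\lambda^*}$. By convention $S_v:=P_v$ and $S_{v^*}:=P_v$ for $v\in\Lambda^0$. The Kumjian-Pask algebra $\mathrm{KP}_R(\Lambda)$ is the $R$-algebra generated by a universal Kumjian-Pask $\Lambda$-family $(p,s)$ (the free $R$-algebra on $\Lambda^0\cup\Lambda^{\neq0}\cup G(\Lambda^{\neq0})$ modulo the relations (KP1)-(KP4)). It is $\mathbb{Z}^k$-graded by $\mathrm{KP}_R(\Lambda)_n=\mathrm{span}_R\{s_\lambda s_{\mu^*}:\lambda,\mu\in\Lambda,\ d(\lambda)-d(\mu)=n\}$, $n\in\mathbb{Z}^k$. An ideal $I$ of $\mathrm{KP}_R(\Lambda)$ is graded if $I=\bigoplus_{n\in\mathbb{Z}^k}(I\cap\mathrm{KP}_R(\Lambda)_n)$; it is basic if $rp_v\in I$ with $v\in\Lambda^0$ and $r\in R\setminus\{0\}$ implies $p_v\in I$. *)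

(* Defs.v *)
From HB Require Import structures.
From mathcomp Require Import all_boot all_order all_algebra generic_quotient.
From mathcomp Require Import mathcomp_extra boolp classical_sets functions.
From mathcomp Require Import cardinality fsbigop.

Set Implicit Arguments.
Unset Strict Implicit.
Unset Printing Implicit Defensive.

Import GRing.Theory.
Local Open Scope classical_set_scope.
Local Open Scope ring_scope.

(* N^k, with its pointwise additive monoid structure, and Z^k. *)
Notation Nk k := {ffun 'I_k -> nat}.
Notation Zk k := {ffun 'I_k -> int}.

Definition leNk k (m n : Nk k) : Prop := forall i, (m i <= n i)%N.
Definition joinNk k (m n : Nk k) : Nk k := [ffun i => maxn (m i) (n i)].
(* Truncated, so only meaningful when [leNk n m]. *)
Definition subNk k (m n : Nk k) : Nk k := [ffun i => (m i - n i)%N].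

(* [cmp] is total, but constrained (and used) only on pairs [l], [m] with
   [src l = rng m]. *)
Record kgraph (k : nat) := KGraph {
  obj : countType;
  mor : countType;
  src : mor -> obj;
  rng : mor -> obj;
  idm : obj -> mor;
  cmp : mor -> mor -> mor;
  deg : mor -> Nk k;
  src_idm : forall v, src (idm v) = v;
  rng_idm : forall v, rng (idm v) = v;
  src_cmp : forall l m, src l = rng m -> src (cmp l m) = src m;
  rng_cmp : forall l m, src l = rng m -> rng (cmp l m) = rng l;
  cmp_idl : forall l, cmp (idm (rng l)) l = l;
  cmp_idr : forall l, cmp l (idm (src l)) = l;
  cmpA : forall l m n, src l = rng m -> src m = rng n ->
    cmp l (cmp m n) = cmp (cmp l m) n;
  deg_idm : forall v, deg (idm v) = 0;
  deg_cmp : forall l m, src l = rng m -> deg (cmp l m) = deg l + deg m;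
  factorization : forall l (m n : Nk k), deg l = m + n ->
    exists! p : mor * mor,
      [/\ deg p.1 = m, deg p.2 = n, src p.1 = rng p.2 & l = cmp p.1 p.2]
}.

Arguments idm {k} _ _.

Section KGraphs.
Variables (k : nat) (L : kgraph k).
Implicit Types (v : obj L) (l : mor L) (H : set (obj L)).

Definition row_finite : Prop :=
  forall v (n : Nk k), finite_set [set l | rng l = v /\ deg l = n].

Definition no_sources : Prop :=
  forall v (n : Nk k), [set l | rng l = v /\ deg l = n] !=set0.

Definition is_segment l (m n : Nk k) l2 : Prop :=
  exists l1 l3,
    [/\ src l1 = rng l2, src l2 = rng l3, l = cmp l1 (cmp l2 l3) &
     [/\ deg l1 = m, deg l2 = subNk n m & deg l3 = subNk (deg l) n]].

(* The paper's l(m, n); a junk value unless m <= n <= deg l. *)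
Definition segment l (m n : Nk k) : mor L := xget l [set l2 | is_segment l m n l2].

Lemma is_segment_segment l (m n : Nk k) : leNk m n -> leNk n (deg l) ->
  forall l2, is_segment l m n l2 <-> l2 = segment l m n.
Proof.
move=> lemn lenl.
have subK (a b : Nk k) : leNk a b -> b = a + subNk b a.
  by move=> ab; apply/ffunP => i; rewrite !ffunE; exact/esym/subnKC.
have lemd : leNk m (deg l) by move=> i; exact: leq_trans (lemn i) (lenl i).
have [[a b] [[/= da db sab lab] uab]] := factorization (subK _ _ lemd).
have eb : subNk (deg l) m = subNk n m + subNk (deg l) n.
  apply/ffunP => i; rewrite !ffunE; apply/esym/eqP.
  change ((n i - m i) + (deg l i - n i) == deg l i - m i)%N.
  by rewrite addnC addnBA ?lemn // subnK.
rewrite eb in db.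
have [[c e] [[/= dc de sce bce] uce]] := factorization db.
have seg_c : is_segment l m n c.
  exists a, e; split; rewrite -?bce //.
  by rewrite sab bce rng_cmp.
have seg_u x : is_segment l m n x -> x = c.
  move=> [l1 [l3 [s12 s23 e123 [d1 d2 d3]]]].
  have [_ bx] : (a, b) = (l1, cmp x l3).
    by apply: uab; split=> //=; rewrite ?rng_cmp // deg_cmp // d2 d3 -eb.
  by have [->] : (c, e) = (x, l3) by apply: uce; split.
have -> : segment l m n = c.
  by apply: seg_u; apply: (xgetPex l (P := [set x | is_segment l m n x])); exists c.
by move=> x; split=> [/seg_u|->].
Qed.

Definition aperiodic : Prop :=
  forall v (m n : Nk k), m <> n ->
  exists l, [/\ rng l = v, leNk (joinNk m n) (deg l) &
    segment l m (m + subNk (deg l) (joinNk m n)) <>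
    segment l n (n + subNk (deg l) (joinNk m n))].

Definition hereditary H : Prop := forall l, H (rng l) -> H (src l).

Definition saturated H : Prop :=
  forall v (n : Nk k), (forall l, rng l = v -> deg l = n -> H (src l)) -> H v.

End KGraphs.

(* The k-graph L \ H; saturation of H is only needed for it to have no
   sources. *)
Section Difference.
Variables (k : nat) (L : kgraph k) (H : set (obj L)) (hH : hereditary H).

Definition diff_obj := {v : obj L | v \notin H}.
Definition diff_mor := {l : mor L | src l \notin H}.
HB.instance Definition _ := Countable.on diff_obj.
HB.instance Definition _ := Countable.on diff_mor.
Implicit Types (v : diff_obj) (l m n : diff_mor).

Lemma diff_rngP l : rng (val l) \notin H.
Proof.
by apply: contraNN (valP l); rewrite !in_setE; exact: hH.
Qed.

Lemma diff_idmP v : src (idm L (val v)) \notin H.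
Proof. by rewrite src_idm (valP v). Qed.

Definition diff_src l : diff_obj := Sub (src (val l)) (valP l).
Definition diff_rng l : diff_obj := Sub (rng (val l)) (diff_rngP l).
Definition diff_idm v : diff_mor := Sub (idm L (val v)) (diff_idmP v).
Definition diff_cmp l m : diff_mor := insubd l (cmp (val l) (val m)).
Definition diff_deg l : Nk k := deg (val l).

Lemma diff_composable l m : diff_src l = diff_rng m ->
  src (val l) = rng (val m).
Proof. by move=> /(congr1 val). Qed.

Lemma diff_cmpE l m : diff_src l = diff_rng m ->
  val (diff_cmp l m) = cmp (val l) (val m).
Proof.
move=> /diff_composable lm; rewrite /diff_cmp val_insubd src_cmp //.
by rewrite (valP m).
Qed.

Fact diff_src_idm v : diff_src (diff_idm v) = v.
Proof. by apply: val_inj; rewrite /= src_idm. Qed.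

Fact diff_rng_idm v : diff_rng (diff_idm v) = v.
Proof. by apply: val_inj; rewrite /= rng_idm. Qed.

Fact diff_src_cmp l m : diff_src l = diff_rng m ->
  diff_src (diff_cmp l m) = diff_src m.
Proof.
move=> lm; apply: val_inj; rewrite /= diff_cmpE // src_cmp //.
exact: diff_composable.
Qed.

Fact diff_rng_cmp l m : diff_src l = diff_rng m ->
  diff_rng (diff_cmp l m) = diff_rng l.
Proof.
move=> lm; apply: val_inj; rewrite /= diff_cmpE // rng_cmp //.
exact: diff_composable.
Qed.

Fact diff_cmp_idl l : diff_cmp (diff_idm (diff_rng l)) l = l.
Proof. by apply: val_inj; rewrite diff_cmpE ?diff_src_idm //= cmp_idl. Qed.

Fact diff_cmp_idr l : diff_cmp l (diff_idm (diff_src l)) = l.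
Proof. by apply: val_inj; rewrite diff_cmpE ?diff_rng_idm //= cmp_idr. Qed.

Fact diff_cmpA l m n : diff_src l = diff_rng m -> diff_src m = diff_rng n ->
  diff_cmp l (diff_cmp m n) = diff_cmp (diff_cmp l m) n.
Proof.
move=> lm mn; apply: val_inj.
rewrite !diff_cmpE ?diff_rng_cmp ?diff_src_cmp // cmpA //.
- exact: diff_composable.
- exact: diff_composable.
Qed.

Fact diff_deg_idm v : diff_deg (diff_idm v) = 0.
Proof. exact: deg_idm. Qed.

Fact diff_deg_cmp l m : diff_src l = diff_rng m ->
  diff_deg (diff_cmp l m) = diff_deg l + diff_deg m.
Proof.
move=> lm; rewrite /diff_deg diff_cmpE // deg_cmp //.
exact: diff_composable.
Qed.

Fact diff_factorization l (m n : Nk k) : diff_deg l = m + n ->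
  exists! p : diff_mor * diff_mor,
    [/\ diff_deg p.1 = m, diff_deg p.2 = n, diff_src p.1 = diff_rng p.2 &
        l = diff_cmp p.1 p.2].
Proof.
move=> /factorization[[a b] [[/= da db sab lab] uab]].
have bH : src b \notin H by rewrite -(src_cmp sab) -lab (valP l).
have aH : src a \notin H by rewrite sab; exact: (diff_rngP (exist _ b bH)).
pose a' : diff_mor := exist _ a aH; pose b' : diff_mor := exist _ b bH.
have sab' : diff_src a' = diff_rng b' by apply: val_inj.
exists (a', b'); split=> [|[x y] [/= dx dy sxy lxy]].
  by split=> //=; apply: val_inj; rewrite diff_cmpE.
have [ax bx] : (a, b) = (val x, val y).
  by apply: uab; split=> //=; rewrite ?lxy ?diff_cmpE //; exact: diff_composable.
by congr pair; apply: val_inj.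
Qed.

Definition kgraph_diff : kgraph k :=
  KGraph diff_src_idm diff_rng_idm diff_src_cmp diff_rng_cmp diff_cmp_idl
    diff_cmp_idr diff_cmpA diff_deg_idm diff_deg_cmp diff_factorization.

End Difference.

(* Associative R-algebras, not assumed to have an identity. *)
HB.mixin Record isNonUnitalAlgebra (R : pzRingType) A of GRing.Lmodule R A := {
  nmul : A -> A -> A;
  nmulA : associative nmul;
  nmulDl : left_distributive nmul +%R;
  nmulDr : right_distributive nmul +%R;
  scalenAl : forall (a : R) (x y : A), a *: nmul x y = nmul (a *: x) y;
  scalenAr : forall (a : R) (x y : A), a *: nmul x y = nmul x (a *: y)
}.

#[short(type="nuAlgType")]
HB.structure Definition NonUnitalAlgebra (R : pzRingType) :=
  {A of GRing.Lmodule R A & isNonUnitalAlgebra R A}.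

Infix "**" := nmul (at level 40, left associativity) : ring_scope.

Section Ideals.
Variables (R : pzRingType) (A : nuAlgType R).

Record ideal (I : set A) : Prop := Ideal {
  ideal0 : I 0;
  idealD : forall x y, I x -> I y -> I (x + y);
  idealZ : forall (a : R) x, I x -> I (a *: x);
  idealMl : forall x y, I y -> I (x ** y);
  idealMr : forall x y, I x -> I (x ** y)
}.

Definition span (X : set A) : set A :=
  [set x | exists s : seq (R * A),
     (forall p, p \in s -> X p.2) /\ x = \sum_(p <- s) p.1 *: p.2].

(* M is the internal direct sum of the family N: it consists of the sums of
   finitely supported families, and such a family is determined by its sum. *)
Definition direct_sum (J : choiceType) (M : set A) (N : J -> set A) : Prop :=
  let family := [set f : J -> A |
    finite_set [set j | f j <> 0] /\ forall j, N j (f j)] in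
  M = [set \sum_(j \in setT) f j | f in family] /\
  forall f g, family f -> family g ->
    \sum_(j \in setT) f j = \sum_(j \in setT) g j -> f = g.

End Ideals.

(* The nonidentity paths (which also index the ghost paths). *)
Definition npath k (L : kgraph k) := {l : mor L | deg l != 0}.
HB.instance Definition _ k (L : kgraph k) := Countable.on (npath L).

Section Families.
Variables (k : nat) (L : kgraph k) (R : pzRingType) (A : nuAlgType R).
Variables (P : obj L -> A) (S G : npath L -> A).

(* G l stands for S_{l^*}. *)
Record KP_family : Prop := KPFamily {
  KP1_idem : forall v, P v ** P v = P v;
  KP1_orth : forall v w, v <> w -> P v ** P w = 0;
  KP2_S : forall l m n : npath L, src (val l) = rng (val m) ->
    val n = cmp (val l) (val m) -> S l ** S m = S n;
  KP2_G : forall l m n : npath L, src (val l) = rng (val m) ->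
    val n = cmp (val l) (val m) -> G m ** G l = G n;
  KP2_PS : forall l : npath L, P (rng (val l)) ** S l = S l;
  KP2_SP : forall l : npath L, S l ** P (src (val l)) = S l;
  KP2_PG : forall l : npath L, P (src (val l)) ** G l = G l;
  KP2_GP : forall l : npath L, G l ** P (rng (val l)) = G l;
  KP3 : forall l m : npath L, deg (val l) = deg (val m) ->
    G l ** S m = if l == m then P (src (val l)) else 0;
  KP4 : forall v (n : Nk k), n != 0 ->
    P v = \sum_(l \in [set l : npath L | rng (val l) = v /\ deg (val l) = n])
            (S l ** G l)
}.

(* The convention S_v = S_{v^*} = P_v. *)
Definition path_ext (F : npath L -> A) (l : mor L) : A :=
  if insub l is Some l' then F l' else P (rng l).

End Families.

Section KumjianPask.
Variables (k : nat) (L : kgraph k) (R : comNzRingType).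

Inductive kp_term :=
  | Tvertex of obj L
  | Tpath of npath L
  | Tghost of npath L
  | Tzero
  | Topp of kp_term
  | Tadd of kp_term & kp_term
  | Tscale of R & kp_term
  | Tmul of kp_term & kp_term.

HB.instance Definition _ := gen_eqMixin kp_term.
HB.instance Definition _ := gen_choiceMixin kp_term.

Local Notation Tsum s := (foldr Tadd Tzero s).

(* The least congruence that satisfies the axioms of R-algebras and (KP1)-(KP4);
   the quotient is thus the free R-algebra on the generators modulo
   (KP1)-(KP4). *)
Inductive kp_eqv : kp_term -> kp_term -> Prop :=
  | Erefl t : kp_eqv t t
  | Esym t u : kp_eqv t u -> kp_eqv u t
  | Etrans t u w : kp_eqv t u -> kp_eqv u w -> kp_eqv t w
  | Eopp t t' : kp_eqv t t' -> kp_eqv (Topp t) (Topp t')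
  | Eadd t t' u u' : kp_eqv t t' -> kp_eqv u u' -> kp_eqv (Tadd t u) (Tadd t' u')
  | Escale a t t' : kp_eqv t t' -> kp_eqv (Tscale a t) (Tscale a t')
  | Emul t t' u u' : kp_eqv t t' -> kp_eqv u u' -> kp_eqv (Tmul t u) (Tmul t' u')
  | EaddA t u w : kp_eqv (Tadd t (Tadd u w)) (Tadd (Tadd t u) w)
  | EaddC t u : kp_eqv (Tadd t u) (Tadd u t)
  | Eadd0 t : kp_eqv (Tadd Tzero t) t
  | EaddN t : kp_eqv (Tadd (Topp t) t) Tzero
  | EscaleA a b t : kp_eqv (Tscale a (Tscale b t)) (Tscale (a * b) t)
  | Escale1 t : kp_eqv (Tscale 1 t) t
  | EscaleDr a t u : kp_eqv (Tscale a (Tadd t u)) (Tadd (Tscale a t) (Tscale a u))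
  | EscaleDl a b t : kp_eqv (Tscale (a + b) t) (Tadd (Tscale a t) (Tscale b t))
  | EmulA t u w : kp_eqv (Tmul t (Tmul u w)) (Tmul (Tmul t u) w)
  | EmulDl t u w : kp_eqv (Tmul (Tadd t u) w) (Tadd (Tmul t w) (Tmul u w))
  | EmulDr t u w : kp_eqv (Tmul t (Tadd u w)) (Tadd (Tmul t u) (Tmul t w))
  | EscaleAl a t u : kp_eqv (Tscale a (Tmul t u)) (Tmul (Tscale a t) u)
  | EscaleAr a t u : kp_eqv (Tscale a (Tmul t u)) (Tmul t (Tscale a u))
  | EKP1_idem v : kp_eqv (Tmul (Tvertex v) (Tvertex v)) (Tvertex v)
  | EKP1_orth v w : v <> w -> kp_eqv (Tmul (Tvertex v) (Tvertex w)) Tzero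
  | EKP2_S (l m n : npath L) : src (val l) = rng (val m) ->
      val n = cmp (val l) (val m) ->
      kp_eqv (Tmul (Tpath l) (Tpath m)) (Tpath n)
  | EKP2_G (l m n : npath L) : src (val l) = rng (val m) ->
      val n = cmp (val l) (val m) ->
      kp_eqv (Tmul (Tghost m) (Tghost l)) (Tghost n)
  | EKP2_PS (l : npath L) : kp_eqv (Tmul (Tvertex (rng (val l))) (Tpath l)) (Tpath l)
  | EKP2_SP (l : npath L) : kp_eqv (Tmul (Tpath l) (Tvertex (src (val l)))) (Tpath l)
  | EKP2_PG (l : npath L) : kp_eqv (Tmul (Tvertex (src (val l))) (Tghost l)) (Tghost l)
  | EKP2_GP (l : npath L) : kp_eqv (Tmul (Tghost l) (Tvertex (rng (val l)))) (Tghost l)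
  | EKP3 (l m : npath L) : deg (val l) = deg (val m) ->
      kp_eqv (Tmul (Tghost l) (Tpath m))
        (if l == m then Tvertex (src (val l)) else Tzero)
  | EKP4 v (n : Nk k) (s : seq (npath L)) : n != 0 -> uniq s ->
      [set` s] = [set l : npath L | rng (val l) = v /\ deg (val l) = n] ->
      kp_eqv (Tvertex v) (Tsum [seq Tmul (Tpath l) (Tghost l) | l <- s]).

Definition kp_eqvb (t u : kp_term) : bool := `[< kp_eqv t u >].

Fact kp_eqvb_refl : reflexive kp_eqvb.
Proof. by move=> t; apply/asboolP; exact: Erefl. Qed.

Fact kp_eqvb_sym : symmetric kp_eqvb.
Proof. by move=> t u; apply/asboolP/asboolP; exact: Esym. Qed.

Fact kp_eqvb_trans : transitive kp_eqvb.
Proof.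
by move=> u t w /asboolP tu /asboolP uw; apply/asboolP; exact: Etrans tu uw.
Qed.

Canonical kp_equiv := EquivRel kp_eqvb kp_eqvb_refl kp_eqvb_sym kp_eqvb_trans.

Definition KP : Type := {eq_quot kp_equiv}%qT.
HB.instance Definition _ := Choice.on KP.

Definition kp_class (t : kp_term) : KP := (\pi_({eq_quot kp_equiv}) t)%qT.
Definition kp_repr (x : KP) : kp_term := repr (x : {eq_quot kp_equiv}%qT).

Lemma kp_reprK : cancel kp_repr kp_class.
Proof. by move=> x; exact: reprK. Qed.

Lemma kp_classP t u : kp_class t = kp_class u <-> kp_eqv t u.
Proof.
by split=> [/eqmodP/asboolP|tu]; last by apply/eqmodP/asboolP.
Qed.

Lemma kp_classK t : kp_eqv (kp_repr (kp_class t)) t.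
Proof. by apply/kp_classP; rewrite kp_reprK. Qed.

Lemma kp_classW (Q : KP -> Prop) : (forall t, Q (kp_class t)) -> forall x, Q x.
Proof. by move=> Qt x; rewrite -(kp_reprK x). Qed.

Definition kp_zero : KP := kp_class Tzero.
Definition kp_opp (x : KP) : KP := kp_class (Topp (kp_repr x)).
Definition kp_add (x y : KP) : KP := kp_class (Tadd (kp_repr x) (kp_repr y)).
Definition kp_scale (a : R) (x : KP) : KP := kp_class (Tscale a (kp_repr x)).
Definition kp_mul (x y : KP) : KP := kp_class (Tmul (kp_repr x) (kp_repr y)).

Lemma kp_oppE t : kp_opp (kp_class t) = kp_class (Topp t).
Proof. by apply/kp_classP/Eopp/kp_classK. Qed.

Lemma kp_addE t u : kp_add (kp_class t) (kp_class u) = kp_class (Tadd t u).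
Proof. by apply/kp_classP/Eadd; exact: kp_classK. Qed.

Lemma kp_scaleE a t : kp_scale a (kp_class t) = kp_class (Tscale a t).
Proof. by apply/kp_classP/Escale/kp_classK. Qed.

Lemma kp_mulE t u : kp_mul (kp_class t) (kp_class u) = kp_class (Tmul t u).
Proof. by apply/kp_classP/Emul; exact: kp_classK. Qed.

Let kpE := (kp_oppE, kp_addE, kp_scaleE, kp_mulE).

Fact kp_addA : associative kp_add.
Proof.
elim/kp_classW=> t; elim/kp_classW=> u; elim/kp_classW=> w.
by rewrite !kpE; apply/kp_classP/EaddA.
Qed.

Fact kp_addC : commutative kp_add.
Proof.
elim/kp_classW=> t; elim/kp_classW=> u.
by rewrite !kpE; apply/kp_classP/EaddC.
Qed.

Fact kp_add0 : left_id kp_zero kp_add.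
Proof. by elim/kp_classW=> t; rewrite !kpE; apply/kp_classP/Eadd0. Qed.

Fact kp_addN : left_inverse kp_zero kp_opp kp_add.
Proof. by elim/kp_classW=> t; rewrite !kpE; apply/kp_classP/EaddN. Qed.

HB.instance Definition _ :=
  GRing.isZmodule.Build KP kp_addA kp_addC kp_add0 kp_addN.

Fact kp_scaleA a b x : kp_scale a (kp_scale b x) = kp_scale (a * b) x.
Proof. by elim/kp_classW: x => t; rewrite !kpE; apply/kp_classP/EscaleA. Qed.

Fact kp_scale1 : left_id 1 kp_scale.
Proof. by elim/kp_classW=> t; rewrite !kpE; apply/kp_classP/Escale1. Qed.

Fact kp_scaleDr : right_distributive kp_scale +%R.
Proof.
move=> a; elim/kp_classW=> t; elim/kp_classW=> u.
by rewrite /GRing.add /= !kpE; apply/kp_classP/EscaleDr.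
Qed.

Fact kp_scaleDl x : {morph kp_scale^~ x : a b / a + b}.
Proof.
elim/kp_classW: x => t a b /=.
by rewrite [RHS]/GRing.add /= !kpE; apply/kp_classP/EscaleDl.
Qed.

HB.instance Definition _ :=
  GRing.Zmodule_isLmodule.Build R KP kp_scaleA kp_scale1 kp_scaleDr kp_scaleDl.

Fact kp_mulA : associative kp_mul.
Proof.
elim/kp_classW=> t; elim/kp_classW=> u; elim/kp_classW=> w.
by rewrite !kpE; apply/kp_classP/EmulA.
Qed.

Fact kp_mulDl : left_distributive kp_mul +%R.
Proof.
elim/kp_classW=> t; elim/kp_classW=> u; elim/kp_classW=> w.
by rewrite /GRing.add /= !kpE; apply/kp_classP/EmulDl.
Qed.

Fact kp_mulDr : right_distributive kp_mul +%R.
Proof.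
elim/kp_classW=> t; elim/kp_classW=> u; elim/kp_classW=> w.
by rewrite /GRing.add /= !kpE; apply/kp_classP/EmulDr.
Qed.

Fact kp_scaleAl (a : R) (x y : KP) : a *: kp_mul x y = kp_mul (a *: x) y.
Proof.
elim/kp_classW: x => t; elim/kp_classW: y => u.
by rewrite /GRing.scale /= !kpE; apply/kp_classP/EscaleAl.
Qed.

Fact kp_scaleAr (a : R) (x y : KP) : a *: kp_mul x y = kp_mul x (a *: y).
Proof.
elim/kp_classW: x => t; elim/kp_classW: y => u.
by rewrite /GRing.scale /= !kpE; apply/kp_classP/EscaleAr.
Qed.

HB.instance Definition _ := isNonUnitalAlgebra.Build R KP
  kp_mulA kp_mulDl kp_mulDr kp_scaleAl kp_scaleAr.

Definition kp_p (v : obj L) : KP := kp_class (Tvertex v).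
Definition kp_s (l : npath L) : KP := kp_class (Tpath l).
Definition kp_g (l : npath L) : KP := kp_class (Tghost l).

(* s_l and s_{l^*} for an arbitrary path l. *)
Definition kp_path : mor L -> KP := path_ext kp_p kp_s.
Definition kp_ghost : mor L -> KP := path_ext kp_p kp_g.

Lemma kp_class_opp t : kp_class (Topp t) = - kp_class t.
Proof. by rewrite /GRing.opp /= kpE. Qed.

Lemma kp_class_add t u : kp_class (Tadd t u) = kp_class t + kp_class u.
Proof. by rewrite /GRing.add /= kpE. Qed.

Lemma kp_class_scale a t : kp_class (Tscale a t) = a *: kp_class t.
Proof. by rewrite /GRing.scale /= kpE. Qed.

Lemma kp_class_mul t u : kp_class (Tmul t u) = kp_class t ** kp_class u.
Proof. by rewrite /nmul /= kpE. Qed.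

Lemma kp_class_sum s :
  kp_class (Tsum s) = \sum_(t <- s) kp_class t.
Proof.
by elim: s => [|t s IHs] /=; rewrite ?big_nil ?big_cons // kp_class_add IHs.
Qed.

Lemma row_finite_npath v (n : Nk k) : row_finite L ->
  finite_set [set l : npath L | rng (val l) = v /\ deg (val l) = n].
Proof.
move=> rf; have vinj : {in val @^-1` [set l | rng l = v /\ deg l = n] &,
    injective (val : npath L -> mor L)} by move=> x y _ _; exact: val_inj.
exact: finite_preimage vinj (rf v n).
Qed.

Lemma KP_family_KP : row_finite L -> KP_family kp_p kp_s kp_g.
Proof.
move=> rf; split; rewrite /kp_p /kp_s /kp_g.
- by move=> *; rewrite -kp_class_mul; exact/kp_classP/EKP1_idem.
- by move=> *; rewrite -kp_class_mul; exact/kp_classP/EKP1_orth.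
- by move=> *; rewrite -kp_class_mul; exact/kp_classP/EKP2_S.
- by move=> *; rewrite -kp_class_mul; exact/kp_classP/EKP2_G.
- by move=> *; rewrite -kp_class_mul; exact/kp_classP/EKP2_PS.
- by move=> *; rewrite -kp_class_mul; exact/kp_classP/EKP2_SP.
- by move=> *; rewrite -kp_class_mul; exact/kp_classP/EKP2_PG.
- by move=> *; rewrite -kp_class_mul; exact/kp_classP/EKP2_GP.
- move=> *; have -> : 0 = kp_class Tzero by [].
  by rewrite -kp_class_mul -(fun_if kp_class); apply/kp_classP/EKP3.
move=> v n n0; have fin := row_finite_npath v n rf.
rewrite fsbig_finite //=.
under eq_bigr do rewrite -kp_class_mul.
rewrite -(big_map (fun l => Tmul (Tpath l) (Tghost l)) xpredT kp_class).
rewrite -kp_class_sum; apply/kp_classP; apply: (EKP4 n0).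
- exact: finmap.fset_uniq.
- exact: fset_setK.
Qed.

Section Universal.
Variables (B : nuAlgType R) (P : obj L -> B) (S G : npath L -> B).
Hypothesis famB : KP_family P S G.

Fixpoint kp_eval (t : kp_term) : B :=
  match t with
  | Tvertex v => P v
  | Tpath l => S l
  | Tghost l => G l
  | Tzero => 0
  | Topp t => - kp_eval t
  | Tadd t u => kp_eval t + kp_eval u
  | Tscale a t => a *: kp_eval t
  | Tmul t u => kp_eval t ** kp_eval u
  end.

Lemma kp_eval_sum s : kp_eval (Tsum s) = \sum_(t <- s) kp_eval t.
Proof. by elim: s => [|t s IHs] /=; rewrite ?big_nil ?big_cons // IHs. Qed.

Lemma kp_eval_eqv t u : kp_eqv t u -> kp_eval t = kp_eval u.
Proof.
move: famB => [p1 p2 q1 q2 q3 q4 q5 q6 r1 r2].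
elim=> //=.
- by move=> ? ? ? _ -> _ ->.
- by move=> ? ? _ ->.
- by move=> ? ? ? ? _ -> _ ->.
- by move=> ? ? ? _ ->.
- by move=> ? ? ? ? _ -> _ ->.
- by move=> *; exact: addrA.
- by move=> *; exact: addrC.
- by move=> *; exact: add0r.
- by move=> *; exact: addNr.
- by move=> *; exact: scalerA.
- by move=> *; exact: scale1r.
- by move=> *; exact: scalerDr.
- by move=> *; exact: scalerDl.
- by move=> *; exact: nmulA.
- by move=> *; exact: nmulDl.
- by move=> *; exact: nmulDr.
- by move=> *; exact: scalenAl.
- by move=> *; exact: scalenAr.
- by move=> l m /r1 ->; case: ifP.
move=> v n s n0 us es; rewrite kp_eval_sum big_map (r2 v n n0) -es.
by rewrite -fsbig_seq.
Qed.

Lemma KP_universal :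
  let is_hom (f : KP -> B) := [/\ forall x y, f (x ** y) = f x ** f y,
    forall v, f (kp_p v) = P v, forall l, f (kp_s l) = S l &
    forall l, f (kp_g l) = G l] in
  exists f : {linear KP -> B}, is_hom f /\
    forall g : {linear KP -> B}, is_hom g -> g =1 f.
Proof.
have evK t : kp_eval (kp_repr (kp_class t)) = kp_eval t.
  exact/kp_eval_eqv/kp_classK.
pose f (x : KP) : B := kp_eval (kp_repr x).
have flin : linear f.
  move=> a; elim/kp_classW=> t; elim/kp_classW=> u.
  by rewrite -kp_class_scale -kp_class_add /f !evK.
pose fm := GRing.isLinear.Build R KP B *:%R f flin.
pose fL : {linear KP -> B} := HB.pack f fm.
exists fL; split.
  split=> [|v|l|l]; rewrite /= /f ?evK //.
  elim/kp_classW=> t; elim/kp_classW=> u.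
  by rewrite -kp_class_mul !evK.
move=> g [gM gP gS gG]; elim/kp_classW=> t; rewrite /= /f evK.
elim: t => [v|l|l||t IHt|t IHt u IHu|a t IHt|t IHt u IHu] /=.
- exact: gP.
- exact: gS.
- exact: gG.
- exact: raddf0.
- by rewrite kp_class_opp linearN IHt.
- by rewrite kp_class_add linearD IHt IHu.
- by rewrite kp_class_scale linearZ_LR IHt.
- by rewrite kp_class_mul gM IHt IHu.
Qed.

End Universal.

Definition kp_component (n : Zk k) : set KP :=
  span [set kp_path lm.1 ** kp_ghost lm.2 | lm in
    [set lm : mor L * mor L | forall i, (deg lm.1 i)%:Z - (deg lm.2 i)%:Z = n i]].

Definition graded (I : set KP) : Prop :=
  direct_sum I (fun n : Zk k => I `&` kp_component n).

Definition basic (I : set KP) : Prop :=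
  forall (v : obj L) (a : R), a != 0 -> I (a *: kp_p v) -> I (kp_p v).

End KumjianPask.

Arguments KP {k} L R.

(* Main.v *)
From HB Require Import structures.
From mathcomp Require Import all_boot all_order all_algebra.
From mathcomp Require Import boolp classical_sets functions.
From mathcomp Require Import cardinality fsbigop.
Require Import Defs.

(** If every quotient graph is aperiodic and [I] is a basic ideal, let [H] be
    the set of vertices [v] with [p_v] in [I].  Write [x] in [I] as a combination
    of distinct monomials [s_l s_{m^*}] with all [m] of the same degree.  For a
    monomial with nonzero coefficient [c] and with [src l] outside [H], choose a
    path [g] from [src l] in the complement of [H] along which all pertinent
    pairs of shifts disagree; then
    [s_{(lg)^*} x s_{mg} = c p_{src g}], so that [src g] lies in [H], which is
    absurd.  Hence every monomial of [x] lies in [I], and [I] is graded.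

    Conversely, if the complement of [H] is periodic at [v], with shifts [m] and
    [n], let the algebra act on the [R]-valued functions on the infinite paths
    avoiding [H].  The kernel is a basic ideal.  Factoring a path from [v] of
    degree [m \/ n] as [m' a = n' b], with [deg m' = m] and [deg n' = n],
    periodicity gives [a x = b x] for every infinite path [x], so the kernel
    contains [s_a - s_b] but not its homogeneous component [s_a]. *)

Set Implicit Arguments.
Unset Strict Implicit.
Unset Printing Implicit Defensive.

Import GRing.Theory.
Local Open Scope classical_set_scope.
Local Open Scope ring_scope.

(** * Degrees, factorizations and aperiodicity *)

Section Degrees.
Variable k : nat.
Implicit Types m n p : Nk k.

Lemma Nk_addE m n i : (m + n) i = (m i + n i)%N.
Proof. by rewrite ffunE. Qed.

Lemma Nk_addI m : injective (+%R m).
Proof.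
by move=> n p e; apply/ffunP => i; apply: (@addnI (m i)); rewrite -!Nk_addE e.
Qed.

Lemma Nk_addIr m : injective (+%R^~ m).
Proof. by move=> n p; rewrite ![_ + m]addrC; exact: Nk_addI. Qed.

Lemma subNkK m n : leNk m n -> m + subNk n m = n.
Proof. by move=> mn; apply/ffunP => i; rewrite Nk_addE ffunE subnKC. Qed.

Lemma leNk_add m n p : n = m + p -> leNk m n.
Proof. by move=> -> i; rewrite Nk_addE leq_addr. Qed.

Lemma leNk_joinl m n : leNk m (joinNk m n).
Proof. by move=> i; rewrite ffunE leq_maxl. Qed.

Lemma leNk_joinr m n : leNk n (joinNk m n).
Proof. by move=> i; rewrite ffunE leq_maxr. Qed.

Lemma leNk_join m n p : leNk m p -> leNk n p -> leNk (joinNk m n) p.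
Proof. by move=> mp np i; rewrite ffunE geq_max mp np. Qed.

End Degrees.

Section KGraphTheory.
Variables (k : nat) (L : kgraph k).
Implicit Types (v w : obj L) (l a b c d g : mor L) (m n p q : Nk k).

Lemma factor l m n : deg l = m + n ->
  exists a b, [/\ deg a = m, deg b = n, src a = rng b & l = cmp a b].
Proof. by move=> /factorization[[a b] [[/= ? ? ? ?] _]]; exists a, b. Qed.

Lemma cmp_inj a b a' b' : src a = rng b -> src a' = rng b' ->
  deg a = deg a' -> cmp a b = cmp a' b' -> a = a' /\ b = b'.
Proof.
move=> ab ab' da e.
have db : deg b = deg b'.
  by apply: (@Nk_addI _ (deg a)); rewrite -deg_cmp // e deg_cmp // da.
have [x [_ u]] := factorization (deg_cmp ab).
have e1 : x = (a, b) by apply: u; split.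
have e2 : x = (a', b') by apply: u; split => //=; rewrite e.
by move: e1; rewrite e2 => -[-> ->].
Qed.

(** Composing [l] with its source identity and with its range identity gives two factorizations of
    [l] with first degree 0. *)
Lemma deg0_idm l : deg l = 0 -> l = idm L (rng l).
Proof.
move=> l0; have [||||//] := @cmp_inj l (idm L (src l)) (idm L (rng l)) l.
- by rewrite rng_idm.
- by rewrite src_idm.
- by rewrite l0 deg_idm.
- by rewrite cmp_idr cmp_idl.
Qed.

Lemma deg0_src l : deg l = 0 -> src l = rng l.
Proof. by move=> /deg0_idm {1}->; rewrite src_idm. Qed.

(* Some segment of [l] starting at [m] differs from the one of the same degree
   starting at [n].  Letting the degree vary makes this evidently stable under
   extensions of [l] on both sides, unlike the condition in [aperiodic]. *)
Definition clash l m n := exists a b c a' b' c',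
  [/\ [/\ deg a = m, deg a' = n & deg b = deg b'],
      [/\ src a = rng b, src b = rng c & l = cmp a (cmp b c)],
      [/\ src a' = rng b', src b' = rng c' & l = cmp a' (cmp b' c')] & b <> b'].

Lemma clash_cmpr l d m n : src l = rng d -> clash l m n -> clash (cmp l d) m n.
Proof.
move=> ld [a [b [c [a' [b' [c' [D [ab bc e] [ab' bc' e'] nb]]]]]]].
have cd : src c = rng d by rewrite -ld e !src_cmp // rng_cmp.
have cd' : src c' = rng d by rewrite -ld e' !src_cmp // rng_cmp.
exists a, b, (cmp c d), a', b', (cmp c' d); split=> //.
- by split; rewrite ?e -?cmpA ?src_cmp ?rng_cmp.
- by split; rewrite ?e' -?cmpA ?src_cmp ?rng_cmp.
Qed.

(** Reading [cmp g l] from degree [m] on, one meets a path of degree [deg g] before [b]; the longer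
    segments that end in [b] and [b'] still differ. *)
Lemma clash_cmpl g l m n : src g = rng l -> clash l m n -> clash (cmp g l) m n.
Proof.
move=> gl [a [b [c [a' [b' [c' [[da da' dbb'] [ab bc e] [ab' bc' e'] nb]]]]]]].
have ga : src g = rng a by rewrite gl e rng_cmp // rng_cmp.
have ga' : src g = rng a' by rewrite gl e' rng_cmp // rng_cmp.
have [x [h [dx dh xh exh]]] : exists x h, [/\ deg x = m, deg h = deg g,
    src x = rng h & cmp g a = cmp x h].
  by apply: factor; rewrite deg_cmp // da addrC.
have [x' [h' [dx' dh' xh' exh']]] : exists x h, [/\ deg x = n, deg h = deg g,
    src x = rng h & cmp g a' = cmp x h].
  by apply: factor; rewrite deg_cmp // da' addrC.
have hb : src h = rng b by rewrite -ab -(src_cmp xh) -exh src_cmp.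
have hb' : src h' = rng b' by rewrite -ab' -(src_cmp xh') -exh' src_cmp.
exists x, (cmp h b), c, x', (cmp h' b'), c'; split.
- by split=> //; rewrite !deg_cmp // dh dh' dbb'.
- split; rewrite ?rng_cmp ?src_cmp //.
  by rewrite -cmpA // cmpA ?rng_cmp // -exh -cmpA ?rng_cmp // -e.
- split; rewrite ?rng_cmp ?src_cmp //.
  by rewrite -cmpA // cmpA ?rng_cmp // -exh' -cmpA ?rng_cmp // -e'.
- by move=> /cmp_inj[]; rewrite ?dh ?dh'.
Qed.

(** The segments compared in [aperiodic] have the largest degree that fits after both shifts, so
    they begin with the shorter segments compared by a [clash] and inherit their difference. *)
Lemma aperiodicP : aperiodic L <->
  forall v m n, m <> n -> exists l, rng l = v /\ clash l m n.
Proof.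
split=> ap v m n mn; have [l] := ap v m n mn.
- move=> [rl le neq]; exists l; split=> //.
  set q := subNk (deg l) (joinNk m n) in neq.
  have eq_ x : leNk x (joinNk m n) -> leNk (x + q) (deg l).
    move=> xj i; rewrite Nk_addE -(subNkK le) Nk_addE leq_add2r; exact: xj.
  have seg x : leNk x (joinNk m n) -> exists a c,
      [/\ deg a = x, src a = rng (segment l x (x + q)),
        src (segment l x (x + q)) = rng c, deg (segment l x (x + q)) = q &
        l = cmp a (cmp (segment l x (x + q)) c)].
    move=> xj; have lex : leNk x (x + q) by exact: leNk_add erefl.
    have /(is_segment_segment lex (eq_ x xj))[a [c [? ? ? [? d2 ?]]]] :
      segment l x (x + q) = segment l x (x + q) by [].
    by exists a, c; split=> //; apply: (@Nk_addI _ x); rewrite d2 subNkK.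
  have [a [c [da ab bc db e]]] := seg m (leNk_joinl m n).
  have [a' [c' [da' ab' bc' db' e']]] := seg n (leNk_joinr m n).
  exists a, (segment l m (m + q)), c, a', (segment l n (n + q)), c'.
  by split=> //; rewrite db db'.
- move=> [rl [a [b [c [a' [b' [c' [[da da' dbb'] [ab bc e] [ab' bc' e'] nb]]]]]]]].
  have dl : deg l = m + (deg b + deg c) by rewrite e !deg_cmp ?rng_cmp // da.
  have dl' : deg l = n + (deg b + deg c') by rewrite e' !deg_cmp ?rng_cmp //
    da' dbb'.
  have le : leNk (joinNk m n) (deg l).
    by apply: leNk_join; [exact: leNk_add dl | exact: leNk_add dl'].
  exists l; split=> //.
  set q := subNk (deg l) (joinNk m n).
  (* Coordinatewise, [q] is [deg b + deg c] or [deg b + deg c'], according to which shift is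
     larger. *)
  have bq : leNk (deg b) q.
    move=> i; rewrite ffunE ffunE; case: (leqP (m i) (n i)) => _.
      by rewrite dl' !Nk_addE addKn leq_addr.
    by rewrite dl !Nk_addE addKn leq_addr.
  have eq_ x : leNk x (joinNk m n) -> leNk (x + q) (deg l).
    move=> xj i; rewrite Nk_addE -(subNkK le) Nk_addE leq_add2r; exact: xj.
  have seg x y z t : leNk x (joinNk m n) -> deg y = x -> deg z = deg b ->
      src y = rng z -> src z = rng t -> l = cmp y (cmp z t) ->
      exists u, src z = rng u /\ segment l x (x + q) = cmp z u.
    move=> xj dy dz yz zt et.
    have lex : leNk x (x + q) by exact: leNk_add erefl.
    have dt : deg t = subNk q (deg b) + subNk (deg l) (x + q).
      apply: (@Nk_addI _ (deg z)); apply: (@Nk_addI _ (deg y)).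
      rewrite -deg_cmp // -deg_cmp ?rng_cmp // -et dy dz.
      by rewrite (addrA (deg b)) subNkK // addrA subNkK //; exact: eq_.
    have [u [u' [du du' uu' et']]] := factor dt.
    have zu : src z = rng u by rewrite zt et' rng_cmp.
    exists u; split => //; apply/esym/is_segment_segment => //;
      first exact: eq_.
    exists y, u'; split; rewrite ?rng_cmp ?src_cmp //.
      by rewrite -cmpA // -et'.
    by split=> //; apply: (@Nk_addI _ x);
      rewrite subNkK // deg_cmp // dz du subNkK.
  have [u [bu ->]] := seg m a b c (leNk_joinl m n) da erefl ab bc e.
  have [u' [bu' ->]] := seg n a' b' c' (leNk_joinr m n) da' (esym dbb') ab' bc' e'.
  by move=> /cmp_inj[].
Qed.

End KGraphTheory.

(** * Aperiodicity of the quotient graphs *)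

Section ClashDiff.
Variables (k : nat) (L : kgraph k) (H : set (obj L)) (hH : hereditary H).

(** Heredity keeps all factors of a path with source outside [H] in the complement, so such a path
    has the same factorizations in both graphs. *)
Lemma clash_diff (l : diff_mor H) m n :
  clash (L := kgraph_diff hH) l m n <-> clash (val l) m n.
Proof.
split.
  move=> [a [b [c [a' [b' [c' [D [ab bc e] [ab' bc' e'] nb]]]]]]].
  exists (val a), (val b), (val c), (val a'), (val b'), (val c').
  have bcE : val (cmp b c) = cmp (val b) (val c) by exact: diff_cmpE.
  have bcE' : val (cmp b' c') = cmp (val b') (val c') by exact: diff_cmpE.
  split.
  - by case: D.
  - split; [exact: diff_composable|exact: diff_composable|].
    rewrite e -bcE; apply: diff_cmpE.
    exact: etrans ab (esym (rng_cmp bc)).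
  - split; [exact: diff_composable|exact: diff_composable|].
    rewrite e' -bcE'; apply: diff_cmpE.
    exact: etrans ab' (esym (rng_cmp bc')).
  - by move=> /val_inj.
have lift a b c : src a = rng b -> src b = rng c -> val l = cmp a (cmp b c) ->
    exists x y z : mor (kgraph_diff hH), [/\ [/\ val x = a, val y = b & val z = c],
      src x = rng y, src y = rng z & l = cmp x (cmp y z)].
  move=> ab bc e.
  have hc : src c \notin H.
    by move: (valP l); rewrite e src_cmp ?rng_cmp // src_cmp.
  have hb : src b \notin H.
    by rewrite bc; exact: (diff_rngP hH (exist _ c hc)).
  have ha : src a \notin H.
    by rewrite ab; exact: (diff_rngP hH (exist _ b hb)).
  exists (exist _ a ha), (exist _ b hb), (exist _ c hc).
  have ab' : diff_src (exist _ a ha) = diff_rng hH (exist _ b hb).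
    exact: val_inj.
  have bc' : diff_src (exist _ b hb) = diff_rng hH (exist _ c hc).
    exact: val_inj.
  split=> //; apply: val_inj.
  rewrite e [RHS](diff_cmpE (hH := hH)) /=; last first.
    by rewrite ab'; apply/esym; exact: (diff_rng_cmp bc').
  by congr cmp; apply/esym; exact: (diff_cmpE bc').
move=> [a [b [c [a' [b' [c' [[da da' db] [ab bc e] [ab' bc' e'] nb]]]]]]].
have [x [y [z [[xa yb zc] xy yz e1]]]] := lift _ _ _ ab bc e.
have [x' [y' [z' [[xa' yb' zc'] xy' yz' e1']]]] := lift _ _ _ ab' bc' e'.
exists x, y, z, x', y', z'; split=> //.
  by split; rewrite /= /diff_deg ?xa ?xa' ?yb ?yb'.
by move=> /(congr1 val); rewrite yb yb'.
Qed.

(** Restates aperiodicity within [L] itself, so that later arguments avoid the subtypes of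
    [kgraph_diff]. *)
Lemma aperiodic_diffP : aperiodic (kgraph_diff hH) <->
  forall v m n, ~ H v -> m <> n ->
    exists l, [/\ rng l = v, ~ H (src l) & clash l m n].
Proof.
split=> [/aperiodicP ap v m n Hv mn|ap].
  have Hv' : v \notin H by apply/negP; rewrite in_setE.
  have [l [rl cl]] := ap (exist _ v Hv' : diff_obj H) m n mn.
  exists (val l); split; [exact: (congr1 val rl)| |exact/clash_diff].
  by have /negP := valP l; rewrite in_setE.
apply/aperiodicP => v m n mn.
have Hv : ~ H (val v) by have /negP := valP v; rewrite in_setE.
have [l [rl Hl cl]] := ap (val v) m n Hv mn.
have Hl' : src l \notin H by apply/negP; rewrite in_setE.
exists (exist _ l Hl' : diff_mor H); split; first exact: val_inj.
exact/clash_diff.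
Qed.

(** A path that clashes for the pairs treated so far is extended at its source for the next pair;
    clashes survive extension at either end. *)
Lemma exists_clashes v (s : seq (Nk k * Nk k)) : aperiodic (kgraph_diff hH) ->
  ~ H v -> (forall p, p \in s -> p.1 <> p.2) ->
  exists l, [/\ rng l = v, ~ H (src l) &
    forall p, p \in s -> clash l p.1 p.2].
Proof.
move=> /aperiodic_diffP ap Hv; elim: s => [|p s IHs] sP.
  by exists (idm L v); rewrite rng_idm src_idm; split.
have [q qs|l [rl Hl cl]] := IHs; first by apply: sP; rewrite inE qs orbT.
have [|d [rd Hd cd]] := ap (src l) p.1 p.2 Hl; first by apply: sP;
  rewrite mem_head.
exists (cmp l d); split; rewrite ?rng_cmp ?src_cmp // => q.
by rewrite inE => /orP[/eqP->|/cl]; [exact: clash_cmpl|exact: clash_cmpr].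
Qed.

End ClashDiff.

(** * Kumjian-Pask families *)

Section NonUnital.
Variables (R : pzRingType) (A : nuAlgType R).
Implicit Types x y : A.

Lemma nmul0x x : 0 ** x = 0.
Proof. by apply: (addIr (0 ** x)); rewrite -nmulDl !add0r. Qed.

Lemma nmulx0 x : x ** 0 = 0.
Proof. by apply: (addIr (x ** 0)); rewrite -nmulDr !add0r. Qed.

Lemma nmul_suml (I : Type) (s : seq I) (F : I -> A) x :
  (\sum_(i <- s) F i) ** x = \sum_(i <- s) F i ** x.
Proof.
by elim: s => [|i s IHs]; rewrite ?big_nil ?big_cons ?nmul0x // nmulDl IHs.
Qed.

Lemma nmul_sumr (I : Type) (s : seq I) (F : I -> A) x :
  x ** (\sum_(i <- s) F i) = \sum_(i <- s) x ** F i.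
Proof.
by elim: s => [|i s IHs]; rewrite ?big_nil ?big_cons ?nmulx0 // nmulDr IHs.
Qed.

End NonUnital.

Section Ideal.
Variables (R : comNzRingType) (A : nuAlgType R) (I : set A).
Hypothesis idealI : ideal I.

Lemma ideal_sum (J : eqType) (s : seq J) (F : J -> A) :
  (forall i, i \in s -> I (F i)) -> I (\sum_(i <- s) F i).
Proof.
move=> sI; rewrite big_seq; apply: (big_ind I) => //.
- exact: ideal0 idealI.
- exact: idealD idealI.
Qed.

End Ideal.

Section Paths.
Variables (k : nat) (L : kgraph k).

(** A list, so that ordinary big operators range over it; row-finiteness makes it exhaustive. *)
Definition paths (v : obj L) (n : Nk k) : seq (mor L) :=
  finmap.enum_fset (fset_set [set l : mor L | rng l = v /\ deg l = n]).

Hypothesis rf : row_finite L.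

Lemma mem_paths v n l : (l \in paths v n) = (rng l == v) && (deg l == n).
Proof.
apply/idP/andP => [|[/eqP rl /eqP dl]].
  by rewrite /paths in_fset_set // inE => -[-> ->].
by rewrite /paths in_fset_set // inE.
Qed.

Lemma uniq_paths v n : uniq (paths v n).
Proof. exact: finmap.fset_uniq. Qed.

End Paths.

(** * Relations for all paths, including identities *)

Section FamilyTheory.
Variables (k : nat) (L : kgraph k) (R : comNzRingType) (A : nuAlgType R).
Variables (P : obj L -> A) (s g : npath L -> A).
Hypotheses (rf : row_finite L) (fam : KP_family P s g).
Local Notation S := (path_ext P s).
Local Notation G := (path_ext P g).
Implicit Types (v : obj L) (l m : mor L).

Lemma path_ext0 (F : npath L -> A) l : deg l = 0 -> path_ext P F l = P (rng l).
Proof. by move=> l0; rewrite /path_ext insubN ?l0 ?eqxx. Qed.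

Lemma path_ext_val (F : npath L -> A) (l : npath L) :
  path_ext P F (val l) = F l.
Proof. by rewrite /path_ext valK. Qed.

Lemma npathP l : deg l = 0 \/ exists l' : npath L, l = val l'.
Proof.
by case: (eqVneq (deg l) 0) => [|nz]; [left|right; exists (exist _ l nz)].
Qed.

Lemma P_S l : P (rng l) ** S l = S l.
Proof.
have [l0|[l' ->]] := npathP l; first by rewrite path_ext0 // (KP1_idem fam).
by rewrite path_ext_val (KP2_PS fam).
Qed.

Lemma S_P l : S l ** P (src l) = S l.
Proof.
have [l0|[l' ->]] := npathP l.
  by rewrite path_ext0 // deg0_src // (KP1_idem fam).
by rewrite path_ext_val (KP2_SP fam).
Qed.

Lemma P_G l : P (src l) ** G l = G l.
Proof.
have [l0|[l' ->]] := npathP l.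
  by rewrite path_ext0 // deg0_src // (KP1_idem fam).
by rewrite path_ext_val (KP2_PG fam).
Qed.

Lemma G_P l : G l ** P (rng l) = G l.
Proof.
have [l0|[l' ->]] := npathP l; first by rewrite path_ext0 // (KP1_idem fam).
by rewrite path_ext_val (KP2_GP fam).
Qed.

Lemma npath_cmp (l m : npath L) : src (val l) = rng (val m) ->
  exists n : npath L, val n = cmp (val l) (val m).
Proof.
move=> lm; suff nz : deg (cmp (val l) (val m)) != 0
  by exists (exist _ (cmp (val l) (val m)) nz).
rewrite deg_cmp //; apply: contra (valP l) => /eqP/ffunP e.
apply/eqP/ffunP => i; move/eqP: (e i).
by rewrite Nk_addE !ffunE addn_eq0 => /andP[/eqP].
Qed.

Lemma S_cmp l m : src l = rng m -> S l ** S m = S (cmp l m).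
Proof.
move=> lm; have [l0|[l' el]] := npathP l.
  by rewrite path_ext0 //
    -(deg0_src l0) lm P_S {1}(deg0_idm l0) -(deg0_src l0) lm cmp_idl.
have [m0|[m' em]] := npathP m.
  by rewrite [S m]path_ext0 // -lm S_P {1}(deg0_idm m0) -lm cmp_idr.
rewrite {}el {}em in lm *; have [n en] := npath_cmp lm.
by rewrite -en !path_ext_val; exact: (KP2_S fam).
Qed.

Lemma G_cmp l m : src l = rng m -> G m ** G l = G (cmp l m).
Proof.
move=> lm; have [l0|[l' el]] := npathP l.
  by rewrite [G l]path_ext0 //
    -(deg0_src l0) lm G_P {1}(deg0_idm l0) -(deg0_src l0) lm cmp_idl.
have [m0|[m' em]] := npathP m.
  by rewrite [G m]path_ext0 // -lm P_G {1}(deg0_idm m0) -lm cmp_idr.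
rewrite {}el {}em in lm *; have [n en] := npath_cmp lm.
by rewrite -en !path_ext_val; exact: (KP2_G fam).
Qed.

Lemma P_neq v w : v != w -> P v ** P w = 0.
Proof. by move=> /eqP; exact: (KP1_orth fam). Qed.

Lemma S_S_neq l m : src l != rng m -> S l ** S m = 0.
Proof.
by move=> lm;
  rewrite -S_P -[S m]P_S nmulA -(nmulA (S l)) P_neq // nmulx0 nmul0x.
Qed.

Lemma G_G_neq l m : src l != rng m -> G m ** G l = 0.
Proof.
move=> lm; rewrite -[G l]P_G -[G m]G_P nmulA -(nmulA (G m)) P_neq 1?eq_sym //.
by rewrite nmulx0 nmul0x.
Qed.

Lemma G_S_neq l m : rng l != rng m -> G l ** S m = 0.
Proof.
by move=> lm;
  rewrite -G_P -[S m]P_S nmulA -(nmulA (G l)) P_neq // nmulx0 nmul0x.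
Qed.

Lemma G_S l m : deg l = deg m -> G l ** S m = if l == m then P (src l) else 0.
Proof.
move=> lm; have [l0|[l' el]] := npathP l.
  have m0 : deg m = 0 by rewrite -lm.
  rewrite !path_ext0 //; case: eqVneq => [<-|nlm].
    by rewrite (KP1_idem fam) deg0_src.
  apply: P_neq; apply: contra nlm => /eqP e.
  by rewrite (deg0_idm l0) (deg0_idm m0) e.
have [m0|[m' em]] := npathP m.
  by move: (valP l'); rewrite -el lm m0 eqxx.
by rewrite {}el {}em in lm *; rewrite !path_ext_val (KP3 fam lm).
Qed.

(** Extends (KP4) to [n = 0], where [idm L v] is the only index. *)
Lemma P_sum v n : P v = \sum_(l <- paths v n) S l ** G l.
Proof.
case: (eqVneq n 0) => [->|n0].
  have memv : idm L v \in paths v 0 by rewrite mem_paths //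
    rng_idm deg_idm !eqxx.
  rewrite (bigD1_seq _ memv (uniq_paths v 0)) /= big1_seq => [|l].
    by rewrite !path_ext0 ?deg_idm // rng_idm (KP1_idem fam) addr0.
  rewrite mem_paths // => /andP[nl /andP[/eqP rl /eqP l0]].
  by move: nl; rewrite (deg0_idm l0) rl eqxx.
rewrite (KP4 fam v n0) [RHS]fsbig_seq ?uniq_paths //.
(* (KP4) ranges over the subtype [npath L]; [val] reindexes it by [paths v n]. *)
pose E := [set l : npath L | rng (val l) = v /\ deg (val l) = n].
have -> : [set` paths v n] = val @` E.
  apply/seteqP; split=> [l /=|_ [l /= [rl dl] <-]].
    rewrite mem_paths // => /andP[/eqP rl /eqP dl].
    have nz : deg l != 0 by rewrite dl.
    by exists (exist _ l nz).
  by rewrite mem_paths // rl dl !eqxx.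
rewrite fsbig_image; last by move=> x y _ _; exact: val_inj.
by apply: eq_fsbigr => l _; rewrite !path_ext_val.
Qed.

Lemma G_S_cmp l m n : src l = rng n -> deg l = deg m ->
  G m ** S (cmp l n) = if m == l then S n else 0.
Proof.
move=> ln d; rewrite -S_cmp // nmulA G_S //; case: eqP => [->|_].
  by rewrite ln P_S.
by rewrite nmul0x.
Qed.

Lemma G_cmp_S l m n : src l = rng n -> deg l = deg m ->
  G (cmp l n) ** S m = if l == m then G n else 0.
Proof.
move=> ln d; rewrite -G_cmp // -nmulA G_S //; case: ifP => _.
  by rewrite ln G_P.
by rewrite nmulx0.
Qed.

(* The two sides extend to a common degree [deg l + m = deg l' + n], where
   the two ways of reading [c] disagree. *)
Lemma clash_G_S l l' c (m n : Nk k) : src l = rng c -> src l' = rng c ->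
  deg l + m = deg l' + n -> clash c m n -> G (cmp l c) ** S (cmp l' c) = 0.
Proof.
move=> lc lc' e [x [y [z [x' [y' [z' [[dx dx' dy] [xy yz ec] [xy' yz' ec'] ny]]]]]]].
have lx : src l = rng x by rewrite lc ec !rng_cmp // rng_cmp.
have lx' : src l' = rng x' by rewrite lc' ec' !rng_cmp // rng_cmp.
have dlx : deg (cmp l x) = deg (cmp l' x') by rewrite !deg_cmp // dx dx'.
have -> : cmp l c = cmp (cmp l x) (cmp y z) by rewrite ec cmpA // rng_cmp.
have -> : cmp l' c = cmp (cmp l' x') (cmp y' z') by rewrite ec' cmpA // rng_cmp.
rewrite -G_cmp ?src_cmp ?rng_cmp // -nmulA G_S_cmp ?src_cmp ?rng_cmp //.
case: eqP => _; last exact: nmulx0.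
rewrite -G_cmp // -nmulA G_S_cmp //.
by case: eqP => [/ny|_]; last exact: nmulx0.
Qed.

End FamilyTheory.

(** * Spanning monomials *)

Section Span.
Variables (R : comNzRingType) (A : nuAlgType R).
Implicit Types (X Y Z : set A) (x y z : A) (a : R).

Lemma span_ind X (Q : A -> Prop) : Q 0 ->
  (forall a x y, X x -> span X y -> Q y -> Q (a *: x + y)) ->
  forall x, span X x -> Q x.
Proof.
move=> Q0 QD _ [s [sX ->]]; elim: s sX => [|t s IHs] sX;
  first by rewrite big_nil.
have sX' p : p \in s -> X p.2 by move=> ps; apply: sX; rewrite inE ps orbT.
rewrite big_cons; apply: QD; last exact: IHs.
  by apply: sX; rewrite mem_head.
by exists s.
Qed.

Lemma span0 X : span X 0.
Proof. by exists [::]; rewrite big_nil. Qed.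

Lemma spanD X x y : span X x -> span X y -> span X (x + y).
Proof.
move=> [s [sX ->]] [t [tX ->]]; exists (s ++ t); rewrite big_cat; split=> // p.
by rewrite mem_cat => /orP[/sX|/tX].
Qed.

Lemma spanZ X a x : span X x -> span X (a *: x).
Proof.
move=> [s [sX ->]]; exists [seq (a * p.1, p.2) | p <- s]; split.
  by move=> _ /mapP[p ps ->]; exact: sX ps.
by rewrite big_map scaler_sumr; apply: eq_bigr => p _; rewrite scalerA.
Qed.

Lemma span_incl X x : X x -> span X x.
Proof.
move=> Xx; exists [:: (1, x)]; rewrite big_seq1 scale1r; split=> // p.
by rewrite inE => /eqP->.
Qed.

Lemma span_sum X (J : eqType) (s : seq J) (F : J -> A) :
  (forall j, j \in s -> span X (F j)) -> span X (\sum_(j <- s) F j).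
Proof.
move=> sX; rewrite big_seq; apply: (big_ind (span X)) => //; first exact: span0.
exact: spanD.
Qed.

Lemma span_span X Y : (forall x, X x -> span Y x) ->
  forall x, span X x -> span Y x.
Proof.
move=> XY; apply: span_ind => [|a x y /XY Yx _ Yy]; first exact: span0.
exact/spanD/Yy/spanZ.
Qed.

Lemma span_mul X Y Z : (forall x y, X x -> Y y -> span Z (x ** y)) ->
  forall x y, span X x -> span Y y -> span Z (x ** y).
Proof.
move=> XYZ x y Xx Yy; move: x Xx; apply: span_ind => [|a x z Xx _ Zz].
  by rewrite nmul0x; exact: span0.
rewrite nmulDl; apply: spanD => //; rewrite -scalenAl; apply: spanZ.
move: y Yy {z Zz}; apply: span_ind => [|b y z Yy _ Zz].
  by rewrite nmulx0; exact: span0.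
by rewrite nmulDr; apply: spanD => //; rewrite -scalenAr; apply: spanZ;
  exact: XYZ.
Qed.

(** Repeated indices are merged by adding their coefficients; the indices are then distinct, though
    the values of [F] need not be. *)
Lemma span_image_uniq (J : eqType) (Q : set J) (F : J -> A) x :
  span (F @` Q) x ->
  exists (s : seq J) (c : J -> R),
    [/\ uniq s, forall j, j \in s -> Q j & x = \sum_(j <- s) c j *: F j].
Proof.
move: x; apply: span_ind => [|a _ y [j Qj <-] _ [s [c [us sQ ->]]]].
  by exists [::], (fun=> 0); rewrite big_nil.
have [js|js] := boolP (j \in s).
  exists s, (fun i => (if i == j then a else 0) + c i); split=> //.
  under [RHS]eq_bigr do rewrite scalerDl.
  rewrite big_split /=; congr (_ + _);
    rewrite (bigD1_seq j) //= eqxx big1 ?addr0 //.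
  by move=> i /negPf ->; rewrite scale0r.
exists (j :: s), (fun i => if i == j then a else c i); split.
- by rewrite /= js.
- by move=> i; rewrite inE => /orP[/eqP->|/sQ].
rewrite big_cons eqxx; congr (_ + _); apply: eq_big_seq => i si.
by case: eqP si js => // -> ->.
Qed.

End Span.

Section KPSpan.
Variables (k : nat) (L : kgraph k) (R : comNzRingType) (rf : row_finite L).
Local Notation P := (@kp_p _ L R).
Local Notation S := (path_ext P (@kp_s _ L R)).
Local Notation G := (path_ext P (@kp_g _ L R)).
Let fam : KP_family P (@kp_s _ L R) (@kp_g _ L R) := KP_family_KP R rf.
Implicit Types (v : obj L) (l m : mor L) (q : mor L * mor L).

Definition monomial q : KP L R := S q.1 ** G q.2.

Definition same_src : set (mor L * mor L) := [set q | src q.1 = src q.2].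

(** (KP4) is inserted between the factors at the common degree [N]: each path in the sum begins with
    paths of degrees [deg l] and [deg m], and (KP3) reduces either side to a tail or to 0. *)
Lemma G_S_span l m : span (monomial @` same_src) (G l ** S m).
Proof.
have [e|] := eqVneq (rng l) (rng m); last first.
  by move=> /(G_S_neq fam) ->; exact: span0.
pose N := joinNk (deg l) (deg m).
rewrite -(G_P fam) e (P_sum rf fam _ N) nmul_sumr nmul_suml.
apply: span_sum => n; rewrite mem_paths // => /andP[_ /eqP dn].
rewrite nmulA -nmulA.
have /factor[a [b [da db ab en]]] : deg n = deg l + subNk N (deg l).
  by rewrite subNkK //; exact: leNk_joinl.
have /factor[a' [b' [da' db' ab' en']]] : deg n = deg m + subNk N (deg m).
  by rewrite subNkK //; exact: leNk_joinr.
rewrite {1}en en' (G_S_cmp fam) // (G_cmp_S fam) //.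
case: ifP => _; last by rewrite nmul0x; exact: span0.
case: ifP => _; last by rewrite nmulx0; exact: span0.
apply: span_incl; exists (b, b') => //=.
by rewrite /same_src /= -(src_cmp ab) -(src_cmp ab') -en -en'.
Qed.

Lemma S_span l : span (monomial @` same_src) (S l).
Proof.
apply: span_incl; exists (l, idm L (src l));
  first by rewrite /same_src /= src_idm.
by rewrite /monomial /= [G _]path_ext0 ?deg_idm // rng_idm (S_P fam).
Qed.

Lemma G_span l : span (monomial @` same_src) (G l).
Proof.
apply: span_incl; exists (idm L (src l), l);
  first by rewrite /same_src /= src_idm.
by rewrite /monomial /= [S _]path_ext0 ?deg_idm // rng_idm (P_G fam).
Qed.

Lemma KP_span (x : KP L R) : span (monomial @` same_src) x.
Proof.
(* The span is stable under [S a] on the left and [G a] on the right, hence under products once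
   their middle factor is expanded by [G_S_span]. *)
have SX a x0 : span (monomial @` same_src) x0 ->
    span (monomial @` same_src) (S a ** x0).
  apply: (span_mul (X := [set S a])); last exact: span_incl.
  move=> _ _ -> [[b c] bc <-]; rewrite /monomial nmulA /=.
  have [ab|ab] := eqVneq (src a) (rng b).
    rewrite (S_cmp fam) //; apply: span_incl; exists (cmp a b, c) => //.
    by rewrite /same_src /= src_cmp.
  by rewrite (S_S_neq fam) // nmul0x; exact: span0.
have XG a x0 : span (monomial @` same_src) x0 ->
    span (monomial @` same_src) (x0 ** G a).
  move=> X0; apply: (span_mul (Y := [set G a]) _ X0); last exact: span_incl.
  move=> _ _ [[b c] bc <-] ->; rewrite /monomial -nmulA /=.
  have [ac|ac] := eqVneq (src a) (rng c).
    rewrite (G_cmp fam) //; apply: span_incl; exists (b, cmp a c) => //.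
    by rewrite /same_src /= src_cmp.
  by rewrite (G_G_neq fam) // nmulx0; exact: span0.
elim/kp_classW: x; elim=> [v|l|l||t IHt|t IHt u IHu|a t IHt|t IHt u IHu].
- have := S_span (idm L v); rewrite path_ext0 ?deg_idm // rng_idm; exact.
- by have := S_span (val l); rewrite path_ext_val; exact.
- by have := G_span (val l); rewrite path_ext_val; exact.
- exact: span0.
- by rewrite kp_class_opp -scaleN1r; exact: spanZ.
- by rewrite kp_class_add; exact: spanD.
- by rewrite kp_class_scale; exact: spanZ.
rewrite kp_class_mul; apply: span_mul IHt IHu.
move=> _ _ [[a b] _ <-] [[c d] _ <-]; rewrite /monomial /= nmulA -(nmulA (S a)).
exact/XG/SX/G_S_span.
Qed.

(** (KP4) at the common source replaces [S a ** G b] by the sum of the [S (cmp a l) ** G (cmp b l)];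
    this raises the ghost degree by any amount, so all terms can be brought to one degree. *)
Lemma KP_normal_form (x : KP L R) : exists n (s : seq (mor L * mor L)) c,
  [/\ uniq s, forall q, q \in s -> src q.1 = src q.2 /\ deg q.2 = n &
      x = \sum_(q <- s) c q *: monomial q].
Proof.
pose Q n : set (mor L * mor L) := [set q | src q.1 = src q.2 /\ deg q.2 = n].
suff [n /span_image_uniq[s [c [? ? ?]]]] : exists n, span (monomial @` Q n) x.
  by exists n, s, c.
have mono n p y : span (monomial @` Q n) y -> span (monomial @` Q (n + p)) y.
  apply: span_span => _ [[a b] [/= ab bn] <-]; rewrite /monomial /=.
  rewrite -(S_P fam) (P_sum rf fam (src a) p) nmul_sumr nmul_suml.
  apply: span_sum => l; rewrite mem_paths // => /andP[/eqP rl /eqP dl].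
  rewrite nmulA -nmulA (S_cmp fam) // (G_cmp fam) -?ab //.
  apply: span_incl; exists (cmp a l, cmp b l) => //.
  by split; rewrite /= ?src_cmp ?deg_cmp -?ab // dl bn.
have := KP_span x; move: x; apply: span_ind => [|a _ y [q q1 <-] _ [n ny]].
  by exists 0; exact: span0.
(* The sum of the two ghost degrees dominates both. *)
exists (deg q.2 + n); apply: spanD; last by rewrite addrC; exact: mono.
by apply/spanZ/mono/span_incl; exists q.
Qed.

(** The algebra need not have an identity; a sum of finitely many vertices replaces it for a single
    element. *)
Lemma KP_right_unit (x : KP L R) : exists y, x ** y = x.
Proof.
(* Asking for the unit property of every larger list [W] lets the induction add vertices. *)
suff [V VP] : exists V : seq (obj L), forall W, uniq W -> {subset V <= W} ->
    x ** (\sum_(v <- W) P v) = x.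
  by exists (\sum_(v <- undup V) P v); apply: VP (undup_uniq V) _ => v;
    rewrite mem_undup.
have := KP_span x; move: x; apply: span_ind => [|a _ y [q q1 <-] _ [V VP]].
  by exists [::] => W _ _; rewrite nmul0x.
exists (rng q.2 :: V) => W uW sW; rewrite nmulDl VP //; last first.
  by move=> v vV; apply: sW; rewrite inE vV orbT.
congr (_ + _); rewrite -scalenAl /monomial -nmulA; congr (_ *: (_ ** _)).
have qW : rng q.2 \in W by apply: sW; rewrite mem_head.
rewrite (bigD1_seq _ qW uW) /= nmulDr (G_P fam) -big_filter nmul_sumr big1_seq ?addr0 //.
move=> v; rewrite /= mem_filter => /andP[nv _].
by rewrite -(G_P fam) -nmulA (P_neq fam) 1?eq_sym // nmulx0.
Qed.

End KPSpan.

(** * The algebra of linear endomorphisms *)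

Section LinearEndo.
Variables (R : comNzRingType) (M : lmodType R).

(** A submodule of [M -> M], from which [lend] inherits its module structure; with composition,
    [lend] is the algebra in which the representations below take values. *)
Definition linear_fun_pred : {pred M -> M} := fun f => `[<linear f>].

Lemma linear_fun_submod : subsemimod_closed linear_fun_pred.
Proof.
split=> [|a f /asboolP lf]; first split.
- by apply/asboolP => a x y; rewrite /= scaler0 addr0.
- move=> f g /asboolP lf /asboolP lg; apply/asboolP => a x y /=.
  rewrite -![(f + g) _]/(f _ + g _).
  by rewrite lf lg scalerDr addrACA.
apply/asboolP => b x y; rewrite -![(a *: f) _]/(a *: f _).
by rewrite lf scalerDr !scalerA mulrC.
Qed.

HB.instance Definition _ :=
  GRing.isSubmodClosed.Build R (M -> M) linear_fun_pred linear_fun_submod.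

Record lend := Lend { lend_fun :> M -> M;
  lendP : lend_fun \in linear_fun_pred }.

HB.instance Definition _ := [isSub for lend_fun].
HB.instance Definition _ := [Choice of lend by <:].
HB.instance Definition _ := [SubChoice_isSubLmodule of lend by <:].

Implicit Types f g h : lend.

Lemma lend_linear f : linear f.
Proof. by have /asboolP := lendP f. Qed.

Lemma lendD f g x : (f + g) x = f x + g x.
Proof. by []. Qed.

Lemma lendZ a f x : (a *: f) x = a *: f x.
Proof. by []. Qed.

Lemma lend_sum (I : Type) (s : seq I) (F : I -> lend) x :
  (\sum_(i <- s) F i) x = \sum_(i <- s) F i x.
Proof.
elim: s => [|i s IHs]; first by rewrite !big_nil.
by rewrite !big_cons lendD IHs.
Qed.

Lemma lend_eq f g : f =1 g -> f = g.
Proof. by move=> fg; apply/val_inj/funext. Qed.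

Lemma lend_comp_subproof f g : (fun x => f (g x)) \in linear_fun_pred.
Proof. by apply/asboolP => a x y; rewrite !lend_linear. Qed.

Definition lend_comp f g := Lend (lend_comp_subproof f g).


Lemma lend_additive f x y : f (x + y) = f x + f y.
Proof. by rewrite -{1}[x]scale1r lend_linear scale1r. Qed.

Lemma lend0 f : f 0 = 0.
Proof. by apply: (addIr (f 0)); rewrite -lend_additive !add0r. Qed.

Lemma lend_scalable f a x : f (a *: x) = a *: f x.
Proof. by have := lend_linear f a x 0; rewrite lend0 !addr0. Qed.

Fact lend_compA : associative lend_comp.
Proof. by move=> f g h; apply: lend_eq. Qed.

Fact lend_compDl : left_distributive lend_comp +%R.
Proof. by move=> f g h; apply: lend_eq. Qed.

Fact lend_compDr : right_distributive lend_comp +%R.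
Proof. by move=> f g h; apply: lend_eq => x; exact: lend_additive. Qed.

Fact lend_scaleAl (a : R) f g : a *: lend_comp f g = lend_comp (a *: f) g.
Proof. by apply: lend_eq. Qed.

Fact lend_scaleAr (a : R) f g : a *: lend_comp f g = lend_comp f (a *: g).
Proof. by apply: lend_eq => x; exact/esym/lend_scalable. Qed.

HB.instance Definition _ := isNonUnitalAlgebra.Build R lend
  lend_compA lend_compDl lend_compDr lend_scaleAl lend_scaleAr.

Lemma lendM f g x : (f ** g) x = f (g x).
Proof. by []. Qed.

End LinearEndo.

(** * The grading *)

Section Grading.
Variables (k : nat) (L : kgraph k) (R : comNzRingType) (rf : row_finite L).
Local Notation KPR := (KP L R).
Local Notation P := (@kp_p _ L R).
Local Notation S := (path_ext P (@kp_s _ L R)).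
Local Notation G := (path_ext P (@kp_g _ L R)).
Let fam : KP_family P (@kp_s _ L R) (@kp_g _ L R) := KP_family_KP R rf.
Local Notation V := (Zk k -> KPR).
Implicit Types (x y : KPR) (d e n : Zk k) (l m : mor L).

Definition Zdeg l : Zk k := [ffun i => (deg l i)%:Z].

Lemma Zdeg_cmp l m : src l = rng m -> Zdeg (cmp l m) = Zdeg l + Zdeg m.
Proof.
by move=> lm; apply/ffunP => i; rewrite !ffunE deg_cmp // Nk_addE PoszD.
Qed.

Lemma shift_linear x d :
  (fun (f : V) n => x ** f (n - d)) \in @linear_fun_pred R V.
Proof.
apply/asboolP => a f g; apply/funext => n.
rewrite -![(a *: _ + _) _]/(a *: _ + _ : KPR) nmulDr.
by rewrite -scalenAr.
Qed.

(** Plays the role of [x t^d] in the Laurent polynomials over the algebra, acting on families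
    indexed by [Zk k]. *)
Definition shift x d : lend V := Lend (shift_linear x d).

Lemma shiftM x y d e : shift x d ** shift y e = shift (x ** y) (d + e).
Proof.
apply: lend_eq => f; apply/funext => n; rewrite lendM /=.
by rewrite nmulA opprD addrA.
Qed.

Lemma shift0 d : shift 0 d = 0.
Proof. by apply: lend_eq => f; apply/funext => n /=; rewrite nmul0x. Qed.

Lemma shiftD x y d : shift (x + y) d = shift x d + shift y d.
Proof. by apply: lend_eq => f; apply/funext => n /=; rewrite nmulDl. Qed.

Lemma shiftZ a x d : shift (a *: x) d = a *: shift x d.
Proof. by apply: lend_eq => f; apply/funext => n /=; rewrite -scalenAl. Qed.

Lemma shift_sum (I : Type) (s : seq I) (F : I -> KPR) d :
  shift (\sum_(i <- s) F i) d = \sum_(i <- s) shift (F i) d.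
Proof.
by elim: s => [|i s IHs]; rewrite ?big_nil ?big_cons ?shift0 // shiftD IHs.
Qed.

Definition shift_p v : lend V := shift (P v) 0.
Definition shift_s (l : npath L) : lend V := shift (kp_s R l) (Zdeg (val l)).
Definition shift_g (l : npath L) : lend V := shift (kp_g R l) (- Zdeg (val l)).

(** The defining relations are homogeneous, so they survive the twist of each generator by its
    degree. *)
Lemma shift_family : KP_family shift_p shift_s shift_g.
Proof.
case: fam => p1 p2 q1 q2 q3 q4 q5 q6 r1 r2.
split; rewrite /shift_p /shift_s /shift_g.
- by move=> v; rewrite shiftM p1 addr0.
- by move=> v w vw; rewrite shiftM p2 // shift0.
- by move=> l m n lm e; rewrite shiftM (q1 _ _ _ lm e) e Zdeg_cmp.
- by move=> l m n lm e;
    rewrite shiftM (q2 _ _ _ lm e) e Zdeg_cmp // opprD addrC.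
- by move=> l; rewrite shiftM q3 add0r.
- by move=> l; rewrite shiftM q4 addr0.
- by move=> l; rewrite shiftM q5 add0r.
- by move=> l; rewrite shiftM q6 addr0.
- move=> l m lm; rewrite shiftM r1 //.
  have -> : Zdeg (val l) = Zdeg (val m) by rewrite /Zdeg lm.
  by rewrite addNr; case: ifP => // _; rewrite shift0.
- move=> v n n0; rewrite (r2 v n n0).
  rewrite !fsbig_finite; try exact: row_finite_npath.
  by rewrite shift_sum; apply: eq_bigr => l _; rewrite shiftM subrr.
Qed.

(** Such a map makes degrees visible as translations, which separates the components. *)
Lemma kp_component_hom : exists Phi : {linear KPR -> lend V},
  forall n x, kp_component n x -> Phi x = shift x n.
Proof.
have [Phi [[PhiM PhiP PhiS PhiG] _]] := KP_universal shift_family.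
exists Phi => n; apply: span_ind => [|a _ y [[l m] /= lm <-] _ IH].
  by rewrite raddf0 shift0.
rewrite linearP shiftD shiftZ IH; congr (_ *: _ + _).
have -> : n = Zdeg l - Zdeg m.
  by apply/ffunP => i; rewrite -lm !ffunE.
have Z0 l' : deg l' = 0 -> Zdeg l' = 0.
  by move=> l0; apply/ffunP => i; rewrite !ffunE l0 ffunE.
rewrite PhiM -shiftM; congr (_ ** _).
  have [l0|[l' ->]] := npathP l; last by rewrite /kp_path path_ext_val PhiS.
  by rewrite /kp_path path_ext0 // Z0 // PhiP.
have [m0|[m' ->]] := npathP m; last by rewrite /kp_ghost path_ext_val PhiG.
by rewrite /kp_ghost path_ext0 // Z0 // oppr0 PhiP.
Qed.

Lemma fsum_supp (J : choiceType) (s : seq J) (F : J -> KPR) :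
  uniq s -> (forall j, F j <> 0 -> j \in s) ->
  \sum_(j \in setT) F j = \sum_(j <- s) F j.
Proof.
move=> us sF; rewrite (fsbigE s) //.
  by apply: eq_bigl => j; rewrite in_setT.
by move=> j _; apply: contraNeq => /eqP; exact: sF.
Qed.

(** The image of the sum acts on the family with value [y] at 0 and 0 elsewhere: the entry at [n]
    receives [h n ** y = h n] from the term [n] and 0 from the others. *)
Lemma kp_component_indep (s : seq (Zk k)) (h : Zk k -> KPR) : uniq s ->
  (forall n, kp_component n (h n)) -> \sum_(n <- s) h n = 0 ->
  forall n, n \in s -> h n = 0.
Proof.
move=> us hn h0 n ns; have [Phi PhiC] := kp_component_hom.
have PhiE j : Phi (h j) = shift (h j) j by exact: PhiC.
have [y yE] := KP_right_unit rf (h n).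
have : Phi (\sum_(n <- s) h n) (fun e => if e == 0 then y else 0) n = 0.
  by rewrite h0 raddf0.
rewrite raddf_sum lend_sum fct_sumE (bigD1_seq n) //= PhiE //= subrr eqxx yE.
rewrite big1 ?addr0 // => j jn; rewrite PhiE //= subr_eq0 eq_sym (negPf jn).
by rewrite nmulx0.
Qed.

Lemma kp_component_sum_inj (f g : Zk k -> KPR) :
  finite_set [set n | f n <> 0] -> finite_set [set n | g n <> 0] ->
  (forall n, kp_component n (f n)) -> (forall n, kp_component n (g n)) ->
  \sum_(n \in setT) f n = \sum_(n \in setT) g n -> f = g.
Proof.
move=> ff fg cf cg.
pose s := finmap.enum_fset (fset_set ([set n | f n <> 0] `|` [set n | g n <> 0])).
have us : uniq s by exact: finmap.fset_uniq.
have mems n : (f n <> 0 \/ g n <> 0) -> n \in s.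
  by move=> fg0; rewrite /s in_fset_set ?finite_setU // inE.
rewrite !(fsum_supp us) => [/eqP||]; try by move=> n nn; apply: mems; tauto.
rewrite -subr_eq0 -sumrB => /eqP e; apply/funext => n.
have [ns|ns] := boolP (n \in s).
  apply/eqP; rewrite -subr_eq0; apply/eqP.
  apply: (kp_component_indep (h := fun n => f n - g n) us _ e ns) => j.
  by apply: spanD (cf j) _; rewrite -scaleN1r; exact: spanZ (cg j).
have : f n = 0 /\ g n = 0.
  by split; apply/eqP; apply: contraNT ns => /eqP ?; apply: mems; tauto.
by move=> [-> ->].
Qed.

Lemma monomial_component q : kp_component (Zdeg q.1 - Zdeg q.2) (monomial R q).
Proof. by apply: span_incl; exists q => // i; rewrite !ffunE. Qed.

(** Grouping the terms by degree leaves each homogeneous part in [I], since every single term is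
    there. *)
Lemma graded_of_monomials (I : set KPR) : ideal I ->
  (forall x, I x -> exists (s : seq (mor L * mor L)) (c : mor L * mor L -> R),
     (forall q, q \in s -> I (c q *: monomial R q)) /\
     x = \sum_(q <- s) c q *: monomial R q) ->
  graded I.
Proof.
move=> idI IM; split; last first.
  move=> f g [ff If] [fg Ig]; apply: kp_component_sum_inj => // n.
    exact: (If n).2.
  exact: (Ig n).2.
apply/seteqP; split=> [x /IM[s [c [sI ->]]]|_ [f [ff If] <-]]; last first.
  rewrite (fsum_supp (s := finmap.enum_fset (fset_set [set n | f n <> 0]))).
  - by apply: ideal_sum => // n _; exact: (If n).1.
  - exact: finmap.fset_uniq.
  - by move=> n fn; rewrite in_fset_set // inE.
pose D q : Zk k := Zdeg q.1 - Zdeg q.2.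
pose f n := \sum_(q <- s | D q == n) c q *: monomial R q.
have fsupp n : f n <> 0 -> n \in undup (map D s).
  rewrite mem_undup => fn; apply/negPn/negP => ns; apply: fn.
  rewrite /f big_seq_cond big1 // => q /andP[qs /eqP Dq].
  by move: ns; rewrite -Dq map_f.
exists f; first split.
- apply: (@sub_finite_set _ _ [set` undup (map D s)]); first exact: fsupp.
  exact: finite_seq.
- move=> n; split.
    by rewrite /f -big_filter; apply: ideal_sum => // q;
      rewrite mem_filter => /andP[_ /sI].
  rewrite /f -big_filter; apply: span_sum => q;
    rewrite mem_filter => /andP[/eqP <- _].
  exact/spanZ/monomial_component.
rewrite (fsum_supp (undup_uniq _) fsupp) /f.
(* After the sums are interchanged, each [q] contributes in degree [D q] only. *)
under eq_bigr do rewrite big_mkcond.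
rewrite exchange_big /=; apply: eq_big_seq => q qs.
rewrite (bigD1_seq (D q)) ?undup_uniq ?mem_undup ?map_f //= eqxx big1 ?addr0 //.
by move=> n nq; rewrite eq_sym (negPf nq).
Qed.

End Grading.

(** * Basic ideals over aperiodic quotients *)

Section BasicGraded.
Variables (k : nat) (L : kgraph k) (R : comNzRingType) (rf : row_finite L).
Local Notation KPR := (KP L R).
Local Notation P := (@kp_p _ L R).
Local Notation S := (path_ext P (@kp_s _ L R)).
Local Notation G := (path_ext P (@kp_g _ L R)).
Let fam : KP_family P (@kp_s _ L R) (@kp_g _ L R) := KP_family_KP R rf.
Variables (I : set KPR) (idI : ideal I).

Definition ideal_vertices : set (obj L) := [set v | I (P v)].

Lemma ideal_S l : ideal_vertices (src l) -> I (S l).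
Proof. by move=> Il; rewrite -(S_P fam); exact: idealMl. Qed.

(** [P (src l) = G l ** P (rng l) ** S l]. *)
Lemma ideal_vertices_hereditary : hereditary ideal_vertices.
Proof.
move=> l Il; rewrite /ideal_vertices /=.
have := G_S fam (erefl (deg l)); rewrite eqxx => <-.
by apply: idealMl => //; rewrite -(P_S fam); exact: idealMr.
Qed.

(** Each summand of (KP4) at [v] has a factor [S l = S l ** P (src l)]. *)
Lemma ideal_vertices_saturated : saturated ideal_vertices.
Proof.
move=> v n vn; rewrite /ideal_vertices /= (P_sum rf fam v n).
apply: ideal_sum => // l; rewrite mem_paths // => /andP[/eqP rl /eqP dl].
by apply: idealMr => //; apply: ideal_S; exact: vn.
Qed.

Hypothesis basicI : basic I.

(* Compressing [x] by a path [cmp _ g] along which all other monomials clash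
   isolates the single term [c q *: P (src g)]. *)
Lemma basic_ideal_coef (n : Nk k) (s : seq (mor L * mor L))
    (c : mor L * mor L -> R) q :
  aperiodic (kgraph_diff ideal_vertices_hereditary) ->
  uniq s -> (forall q, q \in s -> src q.1 = src q.2 /\ deg q.2 = n) ->
  I (\sum_(q <- s) c q *: monomial R q) ->
  q \in s -> c q != 0 -> I (P (src q.1)).
Proof.
move=> ap us sP Ix qs cq; have [q12 dq] := sP q qs.
apply: contrapT => nI.
(* Both first paths are to be extended to the join of their degrees; [shifts] gives the missing
   degrees, which differ when the degrees of the paths do. *)
pose N (q' : mor L * mor L) := joinNk (deg q.1) (deg q'.1).
pose shifts q' := (subNk (N q') (deg q.1), subNk (N q') (deg q'.1)).
have shiftsE q' : deg q.1 + (shifts q').1 = deg q'.1 + (shifts q').2.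
  by rewrite !subNkK //; [exact: leNk_joinr|exact: leNk_joinl].
(* Clashes are required only against first paths of another degree; (KP3) handles those of the same
   degree. *)
have [p /mapP[q']|g [rg Hg cg]] := @exists_clashes _ _ _ _ (src q.1)
    [seq shifts q' | q' <- s & deg q'.1 != deg q.1] ap nI.
  rewrite mem_filter => /andP[/eqP nd _] -> e; apply: nd.
  by apply: (@Nk_addIr _ (shifts q').2); rewrite -shiftsE e.
(* As [I] is basic, a nonzero multiple of [P (src g)] in [I] contradicts the choice of [g];
   compression will produce it. *)
apply: Hg; rewrite /ideal_vertices /=; apply: basicI cq _.
have q1g : src q.1 = rng g by [].
have q2g : src q.2 = rng g by rewrite -q12.
suff <- : G (cmp q.1 g) ** (\sum_(q <- s) c q *: monomial R q) ** S (cmp q.2 g)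
    = c q *: P (src g) by apply: idealMr => //; exact: idealMl.
rewrite nmul_sumr nmul_suml (bigD1_seq q) //= -scalenAr -scalenAl.
rewrite /monomial nmulA -nmulA (G_S_cmp fam) // eqxx.
rewrite -nmulA (S_cmp fam) // (G_S fam) // eqxx (src_cmp q1g).
rewrite -big_filter big1_seq ?addr0 // => q';
  rewrite /= mem_filter => /andP[qq' q's].
have [q12' dq'] := sP q' q's.
rewrite -scalenAr -scalenAl nmulA -nmulA (G_S_cmp fam) ?dq //.
(* The factor [G q'.2 ** S (cmp q.2 g)] vanishes unless the ghost paths agree. *)
case: (eqVneq q'.2 q.2) => [e2|_]; last by rewrite nmulx0 scaler0.
have q1g' : src q'.1 = rng g by rewrite q12' e2.
rewrite -nmulA (S_cmp fam) //.
(* For equal degrees, a nonzero term forces [q'.1 = q.1], hence [q' = q]; for different degrees the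
   clash along [g] kills the term. *)
have [e1|ne1] := eqVneq (deg q'.1) (deg q.1).
  rewrite -(G_cmp fam) // -nmulA (G_S_cmp fam) //.
  case: eqP => [e|_]; last by rewrite nmulx0 scaler0.
  by move: qq'; rewrite [q']surjective_pairing [q]surjective_pairing e e2 eqxx.
rewrite (clash_G_S fam q1g q1g' (shiftsE q')) ?scaler0 //.
by apply: cg; apply: map_f; rewrite mem_filter ne1.
Qed.

Lemma basic_ideal_graded :
  aperiodic (kgraph_diff ideal_vertices_hereditary) -> graded I.
Proof.
move=> ap; apply: (graded_of_monomials rf) => // x Ix.
have [n [s [c [us sP ex]]]] := KP_normal_form rf x.
exists s, c; split=> // q qs.
have [->|cq] := eqVneq (c q) 0; first by rewrite scale0r; exact: ideal0.
apply: idealZ => //; apply: idealMr => //; apply: ideal_S.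
by apply: (basic_ideal_coef ap us sP _ qs cq); rewrite -ex.
Qed.

End BasicGraded.

(** * Infinite paths avoiding a hereditary set *)

Section InfinitePaths.
Variables (k : nat) (L : kgraph k) (H : set (obj L)).
Implicit Types (l a b c : mor L) (m n p q : Nk k) (t : Nk k -> mor L).

(** The remainder of [l] after degree [n], with junk value [l] if there is none. *)
Definition drop_path n l := xget l [set b | exists a,
  [/\ deg a = n, src a = rng b & l = cmp a b]].

Lemma drop_cmp a b : src a = rng b -> drop_path (deg a) (cmp a b) = b.
Proof.
move=> ab; apply: xget_unique => [|b' [a' [da ab' e]]]; first by exists a.
by have [] := cmp_inj ab' ab da (esym e).
Qed.

Definition coherent t := forall n p, exists l,
  src (t n) = rng l /\ t (n + p) = cmp (t n) l.

(* The infinite paths all of whose vertices lie outside [H], each given by its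
   initial segments. *)
Record ipath := IPath {
  ipath_fun :> Nk k -> mor L;
  deg_ipath : forall n, deg (ipath_fun n) = n;
  ipath_coherent : coherent ipath_fun;
  ipath_notin : forall n, ~ H (src (ipath_fun n))
}.
Implicit Types x y z : ipath.

Definition irng x := rng (x 0).

Lemma ipath_ext x y : (x : Nk k -> mor L) =1 y -> x = y.
Proof.
case: x y => [f df cf nf] [g dg cg ng] /= /funext e.
by case: _ / e dg cg ng => *; congr IPath; exact: Prop_irrelevance.
Qed.

(** The segment of degree [m + n] determines that of degree [n]. This suits [iprefix], whose
    segments are explicit only from the degree of the prefix on. *)
Lemma ipath_eq_from m x y : (forall n, x (m + n) = y (m + n)) -> x = y.
Proof.
move=> xy; apply: ipath_ext => n; have := xy n; rewrite addrC.
have [a [xa ->]] := ipath_coherent x n m;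
  have [b [yb ->]] := ipath_coherent y n m.
by move=> /cmp_inj[]//; rewrite !deg_ipath.
Qed.

Lemma rng_ipath x n : rng (x n) = irng x.
Proof.
have [l [xl e]] := ipath_coherent x 0 n.
by rewrite add0r in e; rewrite e rng_cmp.
Qed.

Lemma ipath0 x : x 0 = idm L (irng x).
Proof. exact/deg0_idm/deg_ipath. Qed.

Lemma irng_notin x : ~ H (irng x).
Proof. by have := @ipath_notin x 0; rewrite ipath0 src_idm. Qed.

Definition ishift_fun m x n := drop_path m (x (m + n)).

Lemma ishift_funE m x n :
  src (x m) = rng (ishift_fun m x n) /\ x (m + n) = cmp (x m) (ishift_fun m x n).
Proof.
rewrite /ishift_fun; have [l [xl ->]] := ipath_coherent x m n.
by have := drop_cmp xl; rewrite deg_ipath => ->.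
Qed.

Lemma deg_ishift_fun m x n : deg (ishift_fun m x n) = n.
Proof.
have [xs e] := ishift_funE m x n; apply: (@Nk_addI _ m).
by rewrite -(deg_ipath x (m + n)) e deg_cmp // deg_ipath.
Qed.

Lemma ishift_fun_coherent m x : coherent (ishift_fun m x).
Proof.
move=> n p; have [xs e] := ishift_funE m x n.
have [xs' e'] := ishift_funE m x (n + p).
have [l [xl exl]] := ipath_coherent x (m + n) p.
have sl : src (ishift_fun m x n) = rng l by rewrite -xl e src_cmp.
exists l; split=> //.
have : cmp (x m) (ishift_fun m x (n + p)) = cmp (x m) (cmp (ishift_fun m x n) l).
  by rewrite -e' addrA exl {1}e cmpA.
by move=> /cmp_inj[] //; rewrite rng_cmp.
Qed.

Lemma ishift_fun_notin m x n : ~ H (src (ishift_fun m x n)).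
Proof.
have [xs e] := ishift_funE m x n.
by rewrite -(src_cmp xs) -e; exact: ipath_notin.
Qed.

Definition ishift m x :=
  IPath (deg_ishift_fun m x) (ishift_fun_coherent m x) (@ishift_fun_notin m x).

Lemma ishiftE m x n : x (m + n) = cmp (x m) (ishift m x n).
Proof. by case: (ishift_funE m x n). Qed.

Lemma irng_ishift m x : irng (ishift m x) = src (x m).
Proof. by case: (ishift_funE m x 0). Qed.

Lemma src_ishift m x n : src (x m) = rng (ishift m x n).
Proof. by rewrite rng_ipath irng_ishift. Qed.

Lemma ishift_ishift m n x : ishift n (ishift m x) = ishift (m + n) x.
Proof.
apply: ipath_ext => p; have := ishiftE (m + n) x p.
rewrite -addrA (ishiftE m x (n + p)) (ishiftE m x n) (ishiftE n (ishift m x) p).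
have s1 := src_ishift m x n; have s2 := src_ishift n (ishift m x) p.
have s3 := src_ishift (m + n) x p; rewrite (ishiftE m x n) in s3.
by rewrite cmpA // => /cmp_inj[]; rewrite // src_cmp.
Qed.

Hypothesis hH : hereditary H.

(** The paths [t n] may be too long; truncating each to degree [n] gives an infinite path, and by
    heredity no truncation ends in [H]. *)
Lemma prefixes_ipath t : coherent t -> (forall n, leNk n (deg (t n))) ->
  (forall n, ~ H (src (t n))) ->
  exists x : ipath, forall n, exists b, src (x n) = rng b /\ t n = cmp (x n) b.
Proof.
move=> ct dt nt.
have /choice[f fP] n : exists a, deg a = n /\ exists b, src a = rng b /\ t n = cmp a b.
  have /esym/factor[a [b [da db ab e]]] := subNkK (dt n).
  by exists a; split=> //; exists b.
have cf : coherent f.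
  move=> n p; have [dn [b [fb e]]] := fP n; have [dp [c [fc e']]] := fP (n + p).
  have [l [tl etl]] := ct n p.
  have [a' [b' [da' db' ab' ef]]] := factor dp.
  have bl : src b = rng l by rewrite -tl e src_cmp.
  have bc' : src b' = rng c by rewrite -fc ef src_cmp.
  have : cmp a' (cmp b' c) = cmp (f n) (cmp b l).
    by rewrite cmpA // -ef -e' etl {1}e cmpA.
  move=> /cmp_inj[]; rewrite ?rng_cmp ?dn // => ea _.
  by exists b'; rewrite -ea.
have nf n : ~ H (src (f n)).
  have [dn [b [fb e]]] := fP n; rewrite fb => /hH; rewrite -(src_cmp fb) -e.
  exact: nt.
by exists (IPath (fun n => (fP n).1) cf nf) => n; exact: (fP n).2.
Qed.

(** The paths [cmp l (x n)] are coherent of degree at least [n], so they can be truncated to an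
    infinite path. *)
Lemma iprefix_exists l x : src l = irng x ->
  exists y : ipath, forall n, y (deg l + n) = cmp l (x n).
Proof.
move=> lx; have lxn n : src l = rng (x n) by rewrite rng_ipath.
have [n p|n|n|y yP] := @prefixes_ipath (fun n => cmp l (x n)).
- have [c [xc e]] := ipath_coherent x n p.
  by exists c; rewrite /= src_cmp // e cmpA.
- by rewrite /= deg_cmp // deg_ipath addrC; exact: leNk_add erefl.
- by rewrite /= src_cmp //; exact: ipath_notin.
exists y => n; rewrite addrC; have [b [yb]] := yP (n + deg l).
rewrite ishiftE cmpA //; last by rewrite -src_ishift.
move=> /cmp_inj[|||-> //] //; first by rewrite src_cmp // -src_ishift.
by rewrite deg_cmp // !deg_ipath addrC.
Qed.

(** Total, with the junk value [x] when [l] and [x] do not compose. *)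
Definition iprefix l x :=
  if pselect (src l = irng x) is left lx then projT1 (cid (iprefix_exists lx))
  else x.

Section Prefix.
Variables (l : mor L) (x : ipath).
Hypothesis lx : src l = irng x.

Lemma iprefixE n : iprefix l x (deg l + n) = cmp l (x n).
Proof.
by rewrite /iprefix; case: pselect => // e; case: cid.
Qed.

Lemma iprefix_deg : iprefix l x (deg l) = l.
Proof. by have := iprefixE 0; rewrite addr0 ipath0 -lx cmp_idr. Qed.

Lemma irng_iprefix : irng (iprefix l x) = rng l.
Proof. by rewrite -(rng_ipath _ (deg l)) iprefix_deg. Qed.

Lemma ishift_iprefix : ishift (deg l) (iprefix l x) = x.
Proof.
apply: ipath_ext => n; have := ishiftE (deg l) (iprefix l x) n.
rewrite iprefixE iprefix_deg => /cmp_inj[] //; first by rewrite rng_ipath.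
by rewrite -src_ishift iprefix_deg.
Qed.

End Prefix.

Lemma iprefix_ishift m x : iprefix (x m) (ishift m x) = x.
Proof.
apply: (@ipath_eq_from m) => n.
have := @iprefixE (x m) (ishift m x); rewrite irng_ishift deg_ipath => -> //.
by rewrite -ishiftE.
Qed.

Lemma iprefix_cmp l l' x : src l = rng l' -> src l' = irng x ->
  iprefix (cmp l l') x = iprefix l (iprefix l' x).
Proof.
move=> ll l'x; have lx : src (cmp l l') = irng x by rewrite src_cmp.
apply: (@ipath_eq_from (deg (cmp l l'))) => n.
rewrite iprefixE // deg_cmp // -addrA !iprefixE ?irng_iprefix //.
by rewrite cmpA // l'x rng_ipath.
Qed.

Hypothesis sH : saturated H.

(** By saturation every vertex outside [H] receives a path of degree [one] whose source is outside
    [H]; composing such paths exhausts all degrees. *)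
Lemma ipath_exists v : ~ H v -> exists x, irng x = v.
Proof.
move=> Hv; pose one : Nk k := [ffun=> 1%N].
have /choice[e eP] u : exists l, ~ H u -> [/\ rng l = u, deg l = one & ~ H (src l)].
  apply: contrapT => no; have : ~ H u.
    by move=> Hu; apply: no; exists (idm L u).
  apply; apply: (sH (n := one)) => l rl dl; apply: contrapT => Hl.
  by apply: no; exists l.
pose z := fix z i := if i is i'.+1 then cmp (z i') (e (src (z i'))) else idm L v.
have zP i : [/\ rng (z i) = v, deg (z i) = [ffun=> i] & ~ H (src (z i))].
  elim: i => [|i [rz dz nz]] /=.
    by rewrite rng_idm src_idm deg_idm; split=> //; apply/ffunP => i;
      rewrite !ffunE.
  have [re de ne] := eP _ nz.
  rewrite rng_cmp // src_cmp // deg_cmp // dz de; split=> //.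
  by apply/ffunP => j; rewrite !ffunE [LHS]addn1.
have zc i j : exists l, src (z i) = rng l /\ z (i + j)%N = cmp (z i) l.
  elim: j => [|j [l [zl ezl]]].
    by exists (idm L (src (z i))); rewrite rng_idm addn0 cmp_idr.
  rewrite addnS /=; have [_ _ nz] := zP (i + j)%N; have [re de ne] := eP _ nz.
  set d := e _ in re *; rewrite ezl src_cmp // in re.
  by exists (cmp l d); rewrite rng_cmp // ezl cmpA.
(* [N] bounds every coordinate, so [z (N n)] is long enough, and it is additive, which gives
   coherence. *)
pose N n := (\sum_i n i)%N.
have [n p|n|n|x xP] := @prefixes_ipath (fun n => z (N n)).
- have -> : N (n + p) = (N n + N p)%N.
    by rewrite /N -big_split; apply: eq_bigr => i _; rewrite Nk_addE.
  exact: zc.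
- have [_ -> _] := zP (N n); move=> i.
  by rewrite ffunE /N (bigD1 i) //= leq_addr.
- by have [] := zP (N n).
exists x; have [b [xb e0]] := xP 0.
by have [<- _ _] := zP (N 0); rewrite e0 rng_cmp.
Qed.

End InfinitePaths.

(** * The infinite path representation *)

Section PathRepresentation.
Variables (k : nat) (L : kgraph k) (R : comNzRingType) (rf : row_finite L).
Variables (H : set (obj L)) (hH : hereditary H).
Local Notation X := (ipath H).
Local Notation V := (X -> R^o).
Implicit Types (v : obj L) (l m : mor L) (f : V) (y z : X).
Implicit Types (b : pred X) (h : X -> X).

Lemma guard_linear b h :
  (fun f y => if b y then f (h y) else 0) \in @linear_fun_pred R V.
Proof.
apply/asboolP => a f g; apply/funext => y.
rewrite -![(a *: _ + _) _]/(a *: _ + _ : R^o).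
by case: (b y) => //; rewrite scaler0 addr0.
Qed.

(** Composition with [h], cut off outside [b]: all generators act in this form, and products keep
    it, with the maps composed in reverse order. *)
Definition guard b h : lend V := Lend (guard_linear b h).

Lemma guardM b (b' : pred X) h (h' : X -> X) :
  guard b h ** guard b' h' = guard (fun y => b y && b' (h y)) (h' \o h).
Proof. by apply: lend_eq => f; apply/funext => y /=; case: (b y). Qed.

Lemma eq_guard b (b' : pred X) h (h' : X -> X) :
  b =1 b' -> (forall y, b y -> h y = h' y) ->
  guard b h = guard b' h'.
Proof.
move=> bb hh; apply: lend_eq => f; apply/funext => y /=.
by rewrite -bb; case: ifP => // /hh ->.
Qed.

Lemma guard0 b h : b =1 xpred0 -> guard b h = 0.
Proof. by move=> b0; apply: lend_eq => f; apply/funext => y /=; rewrite b0. Qed.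

Definition rep_p v : lend V := guard (fun y => irng y == v) id.
(** Sends the indicator of [x] to that of [l x] when these compose; [rep_ghost] undoes this. *)
Definition rep_path l : lend V :=
  guard (fun y => y (deg l) == l) (ishift (deg l)).
Definition rep_ghost l : lend V :=
  guard (fun y => irng y == src l) (iprefix hH l).
Definition rep_s (l : npath L) := rep_path (val l).
Definition rep_g (l : npath L) := rep_ghost (val l).

Lemma rep_family : KP_family rep_p rep_s rep_g.
Proof.
split; rewrite /rep_p /rep_s /rep_g /rep_path /rep_ghost.
- by move=> v; rewrite guardM; apply: eq_guard => // y /=; rewrite andbb.
- move=> v w vw; rewrite guardM guard0 // => y /=.
  by case: eqP => //= ->; apply/eqP.
- move=> l m n lm ->; rewrite guardM.
  apply: eq_guard => y /=; last by rewrite ishift_ishift deg_cmp.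
  rewrite deg_cmp // ishiftE; apply/andP/eqP => [[/eqP e1 /eqP e2]|e];
    first by congr cmp.
  have [||e1 e2] := cmp_inj _ lm _ e; last by split; apply/eqP.
    by rewrite rng_ipath irng_ishift.
  by rewrite deg_ipath.
- move=> l m n lm ->; rewrite guardM.
  apply: eq_guard => y /=.
    by rewrite src_cmp //; case: eqP => //= e; rewrite irng_iprefix // lm eqxx.
  by case/andP => /eqP e _; rewrite iprefix_cmp.
- move=> l; rewrite guardM; apply: eq_guard => // y /=.
  by rewrite andbC; case: eqP => //= e;
    rewrite -(rng_ipath y (deg (val l))) e eqxx.
- move=> l; rewrite guardM; apply: eq_guard => // y /=.
  by case: eqP => //= e; rewrite irng_ishift e eqxx.
- by move=> l; rewrite guardM; apply: eq_guard => // y /=; rewrite andbb.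
- move=> l; rewrite guardM; apply: eq_guard => // y /=.
  by case: eqP => //= e; rewrite irng_iprefix // eqxx.
- move=> l m lm; rewrite guardM -lm; case: eqP => [<-|nlm].
    apply: eq_guard => y /=; case: eqP => //= e; last by rewrite ishift_iprefix.
    by rewrite iprefix_deg // eqxx.
  apply: guard0 => y /=; case: eqP => //= e; rewrite iprefix_deg //.
  by apply/eqP => /val_inj.
move=> v n n0; apply: lend_eq => f; apply/funext => y.
rewrite fsbig_finite; last exact: row_finite_npath.
rewrite lend_sum fct_sumE.
(* The summand of [l] multiplies by the indicator of the infinite paths that begin with [l]; at [y]
   only [l = y n] contributes. *)
pose t (l : npath L) := if y (deg (val l)) == val l then f y else 0.
rewrite (eq_bigr t) => [|l _]; last first.
  rewrite lendM /t /=; case: eqP => // e.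
  by rewrite irng_ishift e eqxx -{1}e iprefix_ishift.
rewrite /=; case: eqP => [yv|nyv].
  have nz : deg (y n) != 0 by rewrite deg_ipath.
  rewrite (bigD1_seq (exist _ (y n) nz : npath L)) /=;
    last exact: finmap.fset_uniq.
    rewrite {1}/t /= deg_ipath eqxx -big_filter big1_seq ?addr0 // => l.
    rewrite /= mem_filter => /andP[nl].
    rewrite in_fset_set; last exact: row_finite_npath.
    rewrite inE => -[_ dl]; rewrite /t dl; case: eqP => // e.
    by move: nl; rewrite -val_eqE /= e eqxx.
  rewrite in_fset_set; last exact: row_finite_npath.
  by rewrite inE /= rng_ipath deg_ipath.
rewrite big1_seq // => l /=; rewrite in_fset_set; last exact: row_finite_npath.
rewrite inE => -[rl _]; rewrite /t; case: eqP => // e.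
by case: nyv; rewrite -rl -e rng_ipath.
Qed.

Lemma rep_path_ext l : path_ext rep_p rep_s l = rep_path l.
Proof.
have [l0|[l' ->]] := npathP l; last by rewrite path_ext_val.
rewrite path_ext0 //; apply: eq_guard => y; rewrite l0.
  by rewrite ipath0 {2}(deg0_idm l0);
    apply/eqP/eqP => [->//|/(congr1 (@rng _ L))];
    rewrite !rng_idm.
move=> _; apply: ipath_ext => n; rewrite -{1}[n]add0r ishiftE ipath0.
have -> : irng y = rng (ishift 0 y n)
  by rewrite rng_ipath irng_ishift ipath0 src_idm.
exact: cmp_idl.
Qed.

End PathRepresentation.

(** * Nongraded kernels *)

Section NonGraded.
Variables (k : nat) (L : kgraph k) (R : comNzRingType) (rf : row_finite L).
Variables (H : set (obj L)) (hH : hereditary H) (sH : saturated H).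
Local Notation KPR := (KP L R).
Local Notation P := (@kp_p _ L R).
Local Notation S := (path_ext P (@kp_s _ L R)).
Local Notation V := (ipath H -> R^o).

Lemma path_representation : exists rep : {linear KPR -> lend V},
  [/\ forall x y, rep (x ** y) = rep x ** rep y,
      forall v, rep (P v) = rep_p R H v & forall l, rep (S l) = rep_path R H l].
Proof.
have [rep [[repM repP repS _] _]] := KP_universal (rep_family R rf hH).
exists rep; split=> // l; rewrite -rep_path_ext.
by have [l0|[l' ->]] := npathP l; rewrite ?path_ext_val // !path_ext0.
Qed.

Lemma rep_kernel_ideal (A : nuAlgType R) (rep : {linear KPR -> A}) :
  (forall x y, rep (x ** y) = rep x ** rep y) -> ideal [set x | rep x = 0].
Proof.
move=> repM; split=> [|x y|a x|x y|x y] /=.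
- exact: raddf0.
- by rewrite linearD => -> ->; rewrite addr0.
- by rewrite linearZ_LR => ->; rewrite scaler0.
- by rewrite repM => ->; rewrite nmulx0.
- by rewrite repM => ->; rewrite nmul0x.
Qed.

(** No path of [ipath H] starts in [H], so [P v] acts as 0 for [v] in [H]; for other [v], applying
    [a *: P v] to the constant function 1 and evaluating at a path from [v] gives [a]. *)
Lemma rep_kernel_basic (rep : {linear KPR -> lend V}) :
  (forall v, rep (P v) = rep_p R H v) -> basic [set x | rep x = 0].
Proof.
move=> repP v a a0 /=; rewrite linearZ_LR !repP => e.
have [Hv|/(ipath_exists hH sH)[y yv]] := pselect (H v).
  apply: guard0 => y; apply/eqP => yv.
  by apply: (@irng_notin _ _ _ y); rewrite yv.
have : (a *: rep_p R H v) (fun=> 1) y = 0 by rewrite e.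
rewrite lendZ -[(_ *: _) y]/(a *: _ : R^o) /= yv eqxx => /eqP.
by rewrite -[_ *: _]/(a * 1) mulr1 (negPf a0).
Qed.

Lemma rep_path_eq l l' : src l = src l' ->
  (forall z : ipath H, src l = irng z -> iprefix hH l z = iprefix hH l' z) ->
  rep_path R H l = rep_path R H l'.
Proof.
move=> ll lz; have lz' z : src l' = irng z -> iprefix hH l' z = iprefix hH l z.
  by rewrite -ll => /lz.
(* One half of a symmetric claim: a path that begins with [a] also begins with [b], with the same
   tail. *)
have key a b (y : ipath H) : src a = src b ->
    (forall z : ipath H, src a = irng z -> iprefix hH a z = iprefix hH b z) ->
    y (deg a) = a -> y (deg b) = b /\ ishift (deg b) y = ishift (deg a) y.
  move=> ab abz ya; set z := ishift (deg a) y.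
  have az : src a = irng z by rewrite irng_ishift ya.
  have yE : y = iprefix hH b z by rewrite -abz // -{1}ya iprefix_ishift.
  by rewrite yE iprefix_deg -?ab // ishift_iprefix -?ab.
apply: eq_guard => y.
  by apply/eqP/eqP => [/(key _ _ _ ll lz)[]|/(key _ _ _ (esym ll) lz')[]].
by move=> /eqP /(key _ _ _ ll lz)[].
Qed.

(* [S a - S b] is in the kernel of the representation, but its homogeneous
   component [S a] is not. *)
Lemma nongraded_kernel a b : ~ H (src a) -> Zdeg a <> Zdeg b ->
  rep_path R H a = rep_path R H b ->
  exists I : set KPR, [/\ ideal I, basic I & ~ graded I].
Proof.
move=> Ha nd eab; have [rep [repM repP repS]] := path_representation.
exists [set x | rep x = 0]; split.
- exact: rep_kernel_ideal.
- exact: rep_kernel_basic.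
move=> [eI _]; have : [set x | rep x = 0] (S a - S b).
  by rewrite /= raddfB /= !repS eab subrr.
rewrite eI => -[f [ff If] fE].
(* The evident homogeneous decomposition of [S a - S b]; uniqueness forces [f] to equal it. *)
pose g (n : Zk k) : KPR :=
  if n == Zdeg a then S a else if n == Zdeg b then - S b else 0.
have Scomp l : kp_component (Zdeg l) (S l).
  apply: span_incl; exists (l, idm L (src l)) => /= [i|].
    by rewrite deg_idm !ffunE subr0.
  rewrite /kp_ghost path_ext0 ?deg_idm // rng_idm.
  exact: (S_P (KP_family_KP R rf)).
have gs n : g n <> 0 -> n \in [:: Zdeg a; Zdeg b].
  by rewrite /g !inE; do 2 case: eqP => //.
have fg : f = g.
  apply: (kp_component_sum_inj rf) => //.
  - exact: (@sub_finite_set _ _ [set` [:: Zdeg a; Zdeg b]] gs (finite_seq _)).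
  - by move=> n; exact: (If n).2.
  - move=> n; rewrite /g; case: eqP => [->|_]; first exact: Scomp.
    case: eqP => [->|_]; last exact: span0.
    by rewrite -scaleN1r; apply: spanZ; exact: Scomp.
  rewrite fE (fsum_supp _ gs); last by rewrite /= inE andbT; apply/eqP.
  rewrite big_cons big_seq1 /g !eqxx; case: eqP => // e.
  by case: nd.
(* Thus [S a] would be in the kernel, yet it maps the constant function 1 to a function with value 1
   at [a z]. *)
have := (If (Zdeg a)).1; rewrite fg /g eqxx /= repS => ra.
have [z za] := ipath_exists hH sH Ha.
have : rep_path R H a (fun=> 1) (iprefix hH a z) = 0 by rewrite ra.
by rewrite /= iprefix_deg // eqxx => /eqP; rewrite oner_eq0.
Qed.

Lemma periodic_nongraded v (m n : Nk k) : ~ H v -> m <> n ->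
  (forall l, rng l = v -> ~ H (src l) -> ~ clash l m n) ->
  exists I : set KPR, [/\ ideal I, basic I & ~ graded I].
Proof.
move=> Hv mn ncl; set j := joinNk m n.
have mj := subNkK (leNk_joinl m n); have nj := subNkK (leNk_joinr m n).
rewrite -/j in mj nj.
(* If the two tails differed, they would do so in some degree [p], and a finite segment of [y] would
   clash. *)
have shift_eq (y : ipath H) : irng y = v -> ishift m y = ishift n y.
  move=> yv; apply: ipath_ext => p; apply: contrapT => ne.
  apply: (ncl (y (j + p))); rewrite ?rng_ipath //; first exact: ipath_notin.
  (* Both readings are completed to the common degree [j + p]. *)
  have piece q : q + subNk j q = j -> exists c, src (ishift q y p) = rng c /\
      y (j + p) = cmp (y q) (cmp (ishift q y p) c).
    move=> qj; have -> : j + p = q + (p + subNk j q) by rewrite addrCA addrC qj.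
    have [c [pc e]] := ipath_coherent (ishift q y) p (subNk j q).
    by exists c; rewrite ishiftE e.
  have [c [pc e]] := piece m mj; have [c' [pc' e']] := piece n nj.
  exists (y m), (ishift m y p), c, (y n), (ishift n y p), c'.
  split; [split|split|split|]; rewrite ?deg_ipath //; exact: src_ishift.
have [x xv] := ipath_exists hH sH Hv.
(* The remainders of [x j] after degrees [m] and [n]. *)
pose a := ishift m x (subNk j m); pose b := ishift n x (subNk j n).
have ea : x j = cmp (x m) a by rewrite -mj ishiftE.
have eb : x j = cmp (x n) b by rewrite -nj ishiftE.
have xa : src (x m) = rng a by exact: src_ishift.
have xb : src (x n) = rng b by exact: src_ishift.
have sa : src a = src (x j) by rewrite ea src_cmp.
have sb : src b = src (x j) by rewrite eb src_cmp.
apply: (@nongraded_kernel a b).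
- exact: ipath_notin.
(* Both [m + deg a] and [n + deg b] equal [j], so equal degrees of [a] and [b] would give
   [m = n]. *)
- move=> e; apply: mn.
  have dab : deg a = deg b.
    by apply/ffunP => i; move/ffunP: e => /(_ i); rewrite !ffunE => -[].
  apply: (@Nk_addIr _ (deg a));
    rewrite {2}dab -(deg_ipath x m) -(deg_ipath x n).
  by rewrite -!deg_cmp // -ea -eb.
apply: rep_path_eq; first by rewrite sa sb.
move=> z az; have bz : src b = irng z by rewrite sb -sa.
(* [a z] and [b z] are the tails after [m] and [n] of one infinite path from [v], namely [x j]
   followed by [z]. *)
have yE : iprefix hH (cmp (x m) a) z = iprefix hH (cmp (x n) b) z
  by rewrite -ea -eb.
have := @ishift_iprefix _ _ _ hH (x m) (iprefix hH a z).
have := @ishift_iprefix _ _ _ hH (x n) (iprefix hH b z).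
rewrite !irng_iprefix // -!iprefix_cmp // !deg_ipath => <- // <- //.
rewrite yE; apply: shift_eq.
by rewrite irng_iprefix ?src_cmp // rng_cmp // rng_ipath.
Qed.

End NonGraded.

Theorem theorem5p6 (k : nat) (k_gt0 : (0 < k)%N) (L : kgraph k)
    (L_row_finite : row_finite L) (L_no_sources : no_sources L)
    (R : comNzRingType) :
  (forall I : set (KP L R), ideal I -> basic I -> graded I) <->
  (forall (H : set (obj L)) (hH : hereditary H),
     saturated H -> aperiodic (kgraph_diff hH)).
Proof.
split=> [gr H hH sH|ap I idI bI]; last first.
  apply: (basic_ideal_graded (rf := L_row_finite) (idI := idI) bI); apply: ap.
  exact: ideal_vertices_saturated.
apply/aperiodic_diffP => v m n Hv mn; apply: contrapT => no.
have [|I [idI bI]] := @periodic_nongraded _ _ R L_row_finite _ hH sH v m n Hv mn.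
  by move=> l rl Hl cl; apply: no; exists l.
by apply; exact: gr.
Qed.
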